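(* Let $\alpha>-1$, $1<p\le\infty$ and $q=p/(p-1)$ ($q=1$ if $p=\infty$). For every $f^\ast\in L^p(\mathbb{T})$ and $f=P_\alpha[f^\ast]$, $$|Df(0)|\le\frac{(2+\alpha)\Gamma\!\left(1+\frac{\alpha}{2}\right)^2}{\Gamma(1+\alpha)}\left(\frac{\Gamma\!\left(\frac{1+q}{2}\right)}{\sqrt{\pi}\,\Gamma\!\left(\frac{2+q}{2}\right)}\right)^{1/q}\|f^\ast\|_p,$$ and the constant is best possible.
   Context: $\mathbb{D}$ is the open unit disk, $\mathbb{T}=\partial\mathbb{D}$. For $\alpha>-1$ let $c_\alpha=\frac{\Gamma(1+\alpha/2)^2}{\Gamma(1+\alpha)}$ and $K_\alpha(z)=c_\alpha\frac{(1-|z|^2)^{\alpha+1}}{|1-z|^{\alpha+2}}$. For $f^\ast\in L^1(\mathbb{T})$, $P_\alpha[f^\ast](z)=\frac{1}{2\pi}\int_0^{2\pi}K_\alpha(ze^{-it})f^\ast(e^{it})\,dt$ is the $\alpha$-harmonic function with boundary values $f^\ast$. Norms are normalized: $\|g\|_p=\left(\int_0^{2\pi}|g(e^{it})|^p\frac{dt}{2\pi}\right)^{1/p}$, $\|g\|_\infty$ the essential supremum. For $w=u+iv$, $|Dw(z)|$ is the operator norm of the real Jacobian $\begin{pmatrix}u_x&u_y\\ v_x&v_y\end{pmatrix}$, equal to $|w_z|+|w_{\bar z}|$. *)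

(* Defs.v *)
From HB Require Import structures.
From mathcomp Require Import all_boot all_order all_algebra.
From mathcomp Require Import all_classical all_reals all_analysis ess_sup_inf hoelder.
Set Implicit Arguments. Unset Strict Implicit. Unset Printing Implicit Defensive.
Import Order.TTheory GRing.Theory Num.Theory.
Import numFieldNormedType.Exports.
Local Open Scope classical_set_scope.
Local Open Scope ring_scope.

Section Defs.
Variable R : realType.

Definition Gamma (s : R) : R :=
  (\int[lebesgue_measure]_(t in [set t : R | 0 < t]) (t `^ (s - 1) * expR (- t)))%R.

Definition c_alpha (a : R) : R := Gamma (1 + a / 2) ^+ 2 / Gamma (1 + a).

(* K_alpha(w) for w = X + iY:  c_a (1-|w|^2)^(a+1) / |1-w|^(a+2) *)
Definition K_alpha (a X Y : R) : R :=
  c_alpha a * (1 - (X ^+ 2 + Y ^+ 2)) `^ (a + 1)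
    / (Num.sqrt ((1 - X) ^+ 2 + Y ^+ 2)) `^ (a + 2).

(* Real part of P_alpha[g](x + iy) for a real-valued boundary function g
   (given as g(t) = g*(e^{it}), t in [0, 2pi]); z e^{-it} has real part
   x cos t + y sin t and imaginary part y cos t - x sin t.  Since K_alpha is
   real, P_alpha[u* + i v*] = P_alpha[u*] + i P_alpha[v*]. *)
Definition P_alpha (a : R) (g : R -> R) (x y : R) : R :=
  (2 * pi)^-1 *
  (\int[lebesgue_measure]_(t in `[0, 2 * pi]%classic)
     (K_alpha a (x * cos t + y * sin t) (y * cos t - x * sin t) * g t))%R.

(* |Dw(x0,y0)| = |w_z| + |w_zbar| for w = u + i v, with partial derivatives. *)
Definition Dnorm (u v : R -> R -> R) (x0 y0 : R) : R :=
  let ux := derive1 (fun h => u h y0) x0 in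
  let uy := derive1 (fun h => u x0 h) y0 in
  let vx := derive1 (fun h => v h y0) x0 in
  let vy := derive1 (fun h => v x0 h) y0 in
  (* w_z = ((ux + vy) + i (vx - uy))/2 ; w_zbar = ((ux - vy) + i (vx + uy))/2 *)
  Num.sqrt ((ux + vy) ^+ 2 + (vx - uy) ^+ 2) / 2
  + Num.sqrt ((ux - vy) ^+ 2 + (vx + uy) ^+ 2) / 2.

Definition Tnorm (p : \bar R) (g : R -> R) : \bar R :=
  match p with
  | r%:E => ((((2 * pi)^-1)%R)%:E *
              \int[lebesgue_measure]_(t in `[0%R, (2 * pi)%R]%classic) (`|g t| `^ r)%:E)%E
              `^ r^-1
  | +oo%E => ess_sup (mrestr (@lebesgue_measure R)
                       (measurable_itv `[0, 2 * pi])) (fun t => (`|g t|)%:E)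
  | -oo%E => 0%E
  end.

Definition cmod_fun (u v : R -> R) : R -> R :=
  fun t => Num.sqrt (u t ^+ 2 + v t ^+ 2).

Definition in_Lp (p : \bar R) (u v : R -> R) : Prop :=
  measurable_fun `[0, 2 * pi]%classic u /\
  measurable_fun `[0, 2 * pi]%classic v /\
  (Tnorm p (cmod_fun u v) < +oo)%E.

Definition conj_exp (p : \bar R) : R :=
  match p with
  | r%:E => r / (r - 1)
  | _ => 1
  end.

Definition sharp_const (a : R) (p : \bar R) : R :=
  let q := conj_exp p in
  (2 + a) * Gamma (1 + a / 2) ^+ 2 / Gamma (1 + a) *
  (Gamma ((1 + q) / 2) / (Num.sqrt pi * Gamma ((2 + q) / 2))) `^ q^-1.

End Defs.

(* Main.v *)
(** Differentiating the Poisson integral at the origin turns [|Df(0)|] into the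
    largest pairing of the boundary function with a unit wave
    [d1 cos t + d2 sin t], so Hoelder's inequality (with equality for
    [sgn (cos t) |cos t|^(q-1)]) reduces everything to the moment
    [W q] of [|d1 cos t + d2 sin t|^q].  Both [W] and
    [q |-> Gamma ((1+q)/2) / Gamma ((2+q)/2)] satisfy
    [(q+2) F (q+2) = (q+1) F q]; as [W] is nonincreasing and the Gamma ratio
    is asymptotic to [sqrt (2/q)], they are proportional.  The constant comes
    from [W 1 = 4] for the sine and [W 2 = pi] for every wave, without the Gauss
    integral. *)
Require Import Defs.
From HB Require Import structures.
From mathcomp Require Import all_boot all_order all_algebra.
From mathcomp Require Import all_classical all_reals all_analysis.
From mathcomp Require Import measurable_realfun ess_sup_inf.
From mathcomp Require Import ring lra.
Import Order.TTheory GRing.Theory Num.Theory.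
Import numFieldNormedType.Exports.
Local Open Scope classical_set_scope.
Local Open Scope ring_scope.

(** Only the Gamma values depending on [q] are analysed, at arguments at least 1; those in [c_alpha]
    are carried along unevaluated. With [|t|^r], [r >= 0], the Gamma and moment integrands are
    continuous on the whole line, and [x |x|^r] is differentiable even at 0. Both recursions then
    follow from the fundamental theorem of calculus, with no excision at an endpoint or at a zero of
    the wave. A recursion of step 2 determines its solution only up to a 2-periodic factor;
    monotonicity of [W] together with the growth of the Gamma ratio excludes such a factor. Rotation
    invariance is not invoked: each unit wave is normalised by its own value at [q = 2], so the
    maximising direction, which depends on the function, leaves the constant unchanged. The factor
    [(2 + a) c_a] is the radial derivative of the kernel at the origin: [(1 - |z|^2)^(a+1)] is
    stationary there, and [|1 - z|^-(a+2)] contributes [a + 2] times the wave. *)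

Section AbsPower.
Context {R : realType}.
Implicit Types (r s t x : R).

(** * Powers of the absolute value *)

Lemma is_derive_continuous (f : R -> R) (x d : R) :
  is_derive x 1 f d -> {for x, continuous f}.
Proof.
by move=> [df _]; apply: differentiable_continuous; apply/derivable1_diffP.
Qed.

Lemma continuous_abs_powR r : 0 <= r -> continuous (fun x : R => `|x| `^ r).
Proof.
rewrite le_eqVlt => /predU1P[<-|r0].
  by under eq_fun do rewrite powRr0; exact: cst_continuous.
move=> x; have [->|x0] := eqVneq x 0; last first.
  apply: (@continuous_comp _ _ _ (@Num.norm R R) (@powR R ^~ r)).
    exact: norm_continuous.
  apply: differentiable_continuous; apply/derivable1_diffP.
  by apply: derivable_powR; rewrite in_itv/= andbT normr_gt0.
rewrite /continuous_at normr0 powR0 ?gt_eqF//.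
apply/cvgrPdist_lt => e e0; near=> y.
rewrite sub0r normrN ger0_norm ?powR_ge0//.
(* Monotonicity of the power reduces the claim to [|y| < e^(1/r)], which gives the neighbourhood. *)
have -> : e = (e `^ r^-1) `^ r.
  by rewrite -powRrM mulVf ?gt_eqF// powRr1// ltW.
rewrite gt0_ltr_powR ?nnegrE ?powR_ge0//.
near: y. have := @nbhs0_lt R R (e `^ r^-1). apply; exact: powR_gt0.
Unshelve. all: by end_near. Qed.

(** At 0 the difference quotient is [|h|^r], which tends to 0 for [r > 0]; elsewhere the sign of [x]
    is locally constant. This is the building block of both integrations by parts. *)
Lemma is_derive_mul_abs_powR r x : 0 <= r ->
  is_derive x 1 (fun y : R => y * `|y| `^ r) ((r + 1) * `|x| `^ r).
Proof.
rewrite le_eqVlt => /predU1P[<-|r0].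
  rewrite powRr0 add0r mulr1.
  by under eq_fun do rewrite powRr0 mulr1; exact: is_derive_id.
have [->|x0] := eqVneq x 0.
  rewrite normr0 powR0 ?gt_eqF// mulr0.
  pose f (y : R) := y * `|y| `^ r.
  have lim0 : (fun h : R => h^-1 *: ((f \o shift 0) (h *: (1 : R)) - f 0)) @ 0^' --> (0 : R).
    apply: (@cvg_trans _ ((fun h : R => `|h| `^ r) @ 0^')).
      apply: near_eq_cvg; near=> h.
      have h0 : h != 0 by near: h; exact: nbhs_dnbhs_neq.
      by rewrite /f /= mul0r subr0 addr0 /GRing.scale/= mulr1 mulrA mulVf// mul1r.
    have := continuous_abs_powR r (ltW r0) 0.
    rewrite /continuous_at normr0 powR0 ?gt_eqF// => c.
    exact: cvg_within_filter.
  apply: DeriveDef; first by apply/cvg_ex; exists 0.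
  exact: cvg_lim lim0.
have dp (y : R) : 0 < y -> is_derive y 1 (@powR R ^~ r) (r * y `^ (r - 1)).
  by move=> y0; exact: is_derive1_powR.
have [x_gt0|x_lt0|] := ltgtP x 0; last by move=> xx; rewrite xx eqxx in x0.
  have : is_derive x 1 ((id : R -> R) * (@powR R ^~ r \o (fun y => - y))) ((r + 1) * `|x| `^ r).
    have d1 := dp (- x) _.
    have {}d1 : is_derive (- x) 1 (@powR R ^~ r) (r * (- x) `^ (r - 1)) by apply: d1; lra.
    have d2 : is_derive x (1:R) (fun y => - y) (-1) by exact: is_deriveNid.
    have d3 := @is_derive1_comp R (@powR R ^~ r) (fun y => - y) x _ _ d1 d2.
    apply: is_derive_eq.
    rewrite ltr0_norm// /GRing.scale/=.
    rewrite -(@mulr_powRB1 _ (- x) r) //; last lra.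
    ring.
  apply: near_eq_is_derive.
  near=> y.
  have y0 : y < 0 by near: y; exact: lt_nbhsl.
  by rewrite !fctE /= ltr0_norm.
have : is_derive x 1 ((id : R -> R) * (@powR R ^~ r)) ((r + 1) * `|x| `^ r).
  have d1 := dp x x_lt0.
  apply: is_derive_eq.
  rewrite gtr0_norm// /GRing.scale/=.
  rewrite -(@mulr_powRB1 _ x r) //; last lra.
  ring.
apply: near_eq_is_derive.
near=> y.
have y0 : 0 < y by near: y; exact: lt_nbhsr.
by rewrite !fctE /= gtr0_norm.
Unshelve. all: by end_near. Qed.

End AbsPower.

(** * The Gamma function at arguments at least 1 *)

Section GammaFunction.
Context {R : realType}.
Implicit Types (r s t x : R).
Notation mu := (@lebesgue_measure R).

Lemma integral_derive_y (f F : R -> R) (a l : R) :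
  (forall x, a <= x -> 0 <= f x) -> continuous f ->
  (forall x, is_derive x 1 F (f x)) -> F x @[x --> +oo%R] --> l ->
  (\int[mu]_(x in `[a, +oo[) (f x)%:E = (l - F a)%:E)%E.
Proof.
move=> f0 cf dF Fl; rewrite EFinB; apply: ge0_continuous_FTC2y => //.
- exact: continuous_subspaceT.
- by apply: cvg_at_right_filter; exact: is_derive_continuous (dF a).
- by move=> x _; rewrite derive1E; have [_ ->] := dF x.
Qed.

Lemma continuous_expRM (c : R) : continuous (fun t : R => expR (c * t)).
Proof.
move=> t; apply: (@continuous_comp _ _ _ (fun t : R => c * t) (@expR R)).
  exact: mulrl_continuous.
exact: continuous_expR.
Qed.

Lemma is_derive_expRM (c x : R) :
  is_derive x 1 (fun t : R => expR (c * t)) (c * expR (c * x)).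
Proof.
have d1 : is_derive x 1 (fun t : R => c * t) c.
  have : is_derive x 1 (c \*: (id : R -> R)) (c *: 1) by exact: is_deriveZ.
  by rewrite /GRing.scale/= mulr1.
have := @is_derive1_comp R expR (fun t : R => c * t) x _ _ (is_derive_expR _) d1.
by rewrite mulrC.
Qed.

Lemma cvgy_expR_half : expR (- 2^-1 * t) @[t --> +oo%R] --> (0 : R).
Proof.
rewrite (_ : (fun t : R => _) = (fun z => expR (- z)) \o (fun z => 2^-1 * z)); last first.
  by apply/funext => t /=; rewrite mulNr.
apply: (@cvg_comp _ _ _ _ _ _ (pinfty_nbhs R)); last exact: cvgr_expR.
rewrite (_ : (fun z : R => _) = (fun z => z * 2^-1)); last first.
  by apply/funext => z; rewrite mulrC.
exact: gt0_cvgMly.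
Qed.

Lemma integral_expR_half :
  (\int[mu]_(t in `[0%R, +oo[) (expR (- 2^-1 * t))%:E = 2%:E)%E.
Proof.
transitivity ((0 - (- 2 * expR (- 2^-1 * 0)) : R)%:E); last first.
  by rewrite mulr0 expR0; congr EFin; ring.
apply: (@integral_derive_y _ (fun t => - 2 * expR (- 2^-1 * t))).
- by move=> x _; exact: expR_ge0.
- exact: continuous_expRM.
- move=> x; have d := is_derive_expRM (- 2^-1) x.
  have : is_derive x 1 ((- 2) \*: (fun t : R => expR (- 2^-1 * t))) (expR (- 2^-1 * x)).
    by apply: is_derive_eq; rewrite /GRing.scale/=; field.
  by [].
- rewrite -[X in _ --> X](mulr0 (- 2)); apply: cvgMr; exact: cvgy_expR_half.
Qed.

Lemma integrable_expR_half :
  mu.-integrable `[0, +oo[ (EFin \o (fun t : R => expR (- 2^-1 * t))).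
Proof.
apply/integrableP; split.
  apply/measurable_EFinP; apply: measurable_funTS.
  apply: continuous_measurable_fun; exact: continuous_expRM.
under eq_integral do rewrite /= ger0_norm ?expR_ge0//.
by rewrite integral_expR_half ltry.
Qed.

(** Raise [t / (2r) <= exp (t / (2r))] to the power [r]. Half of the decay of [exp (-t)] can then
    absorb the power, leaving the integrable bound [M exp (-t/2)]. *)
Lemma abs_powR_le_expR r : 0 <= r ->
  exists2 M : R, 0 < M & forall t, 0 <= t -> `|t| `^ r <= M * expR (2^-1 * t).
Proof.
rewrite le_eqVlt => /predU1P[<-|r0].
  exists 1 => // t t0; rewrite powRr0 mul1r; have := expR_ge1Dx (2^-1 * t); lra.
exists ((2 * r) `^ r); first by rewrite powR_gt0 ?mulr_gt0.
move=> t t0; rewrite ger0_norm//.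
have -> : 2^-1 * t = (t / (2 * r)) * r by field; rewrite gt_eqF.
rewrite expRM -powRM ?expR_ge0 ?mulr_ge0// ?(ltW r0)//.
rewrite ge0_ler_powR ?nnegrE ?(ltW r0)// ?mulr_ge0 ?expR_ge0// ?(ltW r0)//.
have : t / (2 * r) <= expR (t / (2 * r)).
  by apply: le_trans (expR_ge1Dx _); lra.
by rewrite ler_pdivrMr ?mulr_gt0// mulrC.
Qed.

Lemma abs_powR_expRN_le r : 0 <= r ->
  exists2 M : R, 0 < M & forall t, 0 <= t ->
    `|t| `^ r * expR (- 1 * t) <= M * expR (- 2^-1 * t).
Proof.
move=> /abs_powR_le_expR[M M0 hM]; exists M => // t t0.
have -> : - 2^-1 * t = 2^-1 * t + (- 1 * t) by field.
by rewrite expRD mulrA ler_wpM2r ?expR_ge0// hM.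
Qed.

Lemma continuous_Gamma_integrand r : 0 <= r ->
  continuous (fun t : R => `|t| `^ r * expR (- 1 * t)).
Proof.
move=> r0 t; apply: cvgM; first exact: continuous_abs_powR.
exact: continuous_expRM.
Qed.

Lemma integrable_Gamma_integrand r : 0 <= r ->
  mu.-integrable `[0, +oo[ (EFin \o (fun t : R => `|t| `^ r * expR (- 1 * t))).
Proof.
move=> r0; have [M M0 hM] := abs_powR_expRN_le r r0.
apply: (@le_integrable _ _ _ mu _ _ _ (EFin \o (fun t : R => M * expR (- 2^-1 * t)))) => //.
- apply/measurable_EFinP; apply: measurable_funTS.
  apply: continuous_measurable_fun; exact: continuous_Gamma_integrand.
- move=> t /=; rewrite in_itv/= andbT => t0; rewrite lee_fin.
  rewrite [leLHS]ger0_norm ?mulr_ge0 ?expR_ge0 ?powR_ge0//.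
  by rewrite [leRHS]ger0_norm ?mulr_ge0 ?expR_ge0 ?(ltW M0)//; exact: hM.
- have /= := @integrableZl _ _ _ mu _ (measurable_itv _) M _ integrable_expR_half.
  by apply: eq_integrable => // x _ /=; rewrite EFinM.
Qed.

(** Replacing [t] by [|t|] changes nothing on the open half-line and gives an integrand continuous
    on all of R, so the endpoint 0 can be included. *)
Lemma GammaE r : 0 <= r ->
  Gamma (r + 1) = \int[mu]_(t in `[0, +oo[) (`|t| `^ r * expR (- 1 * t)).
Proof.
move=> r0; rewrite /Gamma addrK -Rintegral_itv_obnd_cbnd; last first.
  apply: integrableS (integrable_Gamma_integrand r r0) => //.
  by apply: subset_itvr; rewrite bnd_simp.
rewrite set_itvoy; apply: eq_Rintegral => t; rewrite inE/= => t0.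
by rewrite gtr0_norm// mulN1r.
Qed.

(** Integration by parts with primitive [t |t|^r exp (-t)]. Its derivative changes sign, whereas
    [integral_derive_y] asks for a nonnegative integrand; adding [M exp (-t/2)], which dominates the
    negative term, repairs this. The added term integrates to [2 M], matching the boundary value
    [- F 0], and cancels at the end. *)
Lemma Gamma_rec s : 1 <= s -> Gamma (s + 1) = s * Gamma s.
Proof.
move=> s1; pose r := s - 1; have r0 : 0 <= r by rewrite subr_ge0.
have r10 : 0 <= r + 1 by rewrite addr_ge0.
have -> : s = r + 1 by rewrite subrK.
have [M M0 hM] := abs_powR_expRN_le (r + 1) r10.
rewrite (GammaE (r + 1))// GammaE//.
have ig := integrable_Gamma_integrand r r0.
have ig1 := integrable_Gamma_integrand (r + 1) r10.
pose e (t : R) := expR (- 1 * t); pose e2 (t : R) := expR (- 2^-1 * t).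
pose f (t : R) := (r + 1) * (`|t| `^ r * e t) - t * `|t| `^ r * e t + M * e2 t.
pose F (t : R) := t * `|t| `^ r * e t + (- 2 * M) * e2 t.
have absE t : 0 <= t -> t * `|t| `^ r = `|t| `^ (r + 1).
  by move=> t0; rewrite ger0_norm// -(@mulr_powRB1 _ t (r + 1)) ?addrK// ltr_wpDl.
have : (\int[mu]_(t in `[0%R, +oo[) (f t)%:E = (0 - F 0)%:E)%E.
  apply: integral_derive_y.
  - move=> t t0; rewrite /f absE// -addrA addr_ge0//.
      by rewrite mulr_ge0// mulr_ge0 ?powR_ge0 ?expR_ge0.
    by rewrite addrC subr_ge0; exact: hM.
  - move=> t; apply: cvgD; first apply: cvgB.
    + by apply: cvgM; [exact: cvg_cst|exact: continuous_Gamma_integrand].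
    + apply: cvgM; last exact: continuous_expRM.
      exact: is_derive_continuous (is_derive_mul_abs_powR r t r0).
    + by apply: cvgM; [exact: cvg_cst|exact: continuous_expRM].
  - move=> t; have d1 := is_derive_mul_abs_powR r t r0.
    have d2 := is_derive_expRM (-1) t; have d3 := is_derive_expRM (- 2^-1) t.
    have : is_derive t 1 ((fun y : R => y * `|y| `^ r) * (fun t => expR (-1 * t))
        + (- 2 * M) \*: (fun t => expR (- 2^-1 * t))) (f t).
      by apply: is_derive_eq; rewrite /f /e /e2 /GRing.scale/=; field.
    by [].
  - rewrite -[X in _ --> X](addr0 (0 : R)); apply: cvgD; last first.
      rewrite -[X in _ --> X](mulr0 (- 2 * M)); apply: cvgMr; exact: cvgy_expR_half.
    apply: (@squeeze_cvgr _ _ _ _ (cst 0) (fun t => M * e2 t)).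
    + near=> t; have t0 : 0 <= t by near: t; exact: nbhs_pinfty_ge.
      rewrite absE// mulr_ge0 ?powR_ge0 ?expR_ge0//=; exact: hM.
    + exact: cvg_cst.
    + rewrite -[X in _ --> X](mulr0 M); apply: cvgMr; exact: cvgy_expR_half.
have -> : 0 - F 0 = 2 * M by rewrite /F /e2 mulr0 expR0; ring.
have ie2 : mu.-integrable `[0, +oo[ (EFin \o (fun t => M * e2 t)).
  have /= := @integrableZl _ _ _ mu _ (measurable_itv _) M _ integrable_expR_half.
  by apply: eq_integrable => // x _ /=; rewrite EFinM.
have ir : mu.-integrable `[0, +oo[ (EFin \o (fun t => (r + 1) * (`|t| `^ r * e t))).
  have /= := @integrableZl _ _ _ mu _ (measurable_itv _) (r + 1) _ ig.
  by apply: eq_integrable => // x _ /=; rewrite EFinM.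
move=> /(congr1 fine) /=.
have -> : fine (\int[mu]_(t in `[0%R, +oo[) (f t)%:E)%E =
    \int[mu]_(t in `[0, +oo[) ((r + 1) * (`|t| `^ r * e t) - `|t| `^ (r + 1) * e t + M * e2 t).
  apply: eq_Rintegral => t; rewrite inE/= in_itv/= andbT => t0.
  by rewrite /f absE.
rewrite RintegralD//; last first.
  have /= := @integrableB _ _ _ mu _ _ _ _ ir ig1.
  by move=> /(_ (measurable_itv _)); apply: eq_integrable => // x _ /=; rewrite EFinB.
rewrite RintegralB// RintegralZl// RintegralZl//; last exact: integrable_expR_half.
have -> : \int[mu]_(t in `[0, +oo[) e2 t = 2 by rewrite /Rintegral integral_expR_half.
rewrite (mulrC 2) /e; lra.
Unshelve. all: by end_near. Qed.

(** On [[1, 2]] the integrand is at least [exp (-2)]. *)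
Lemma Gamma_gt0 s : 1 <= s -> 0 < Gamma s.
Proof.
move=> s1; pose r := s - 1; have r0 : 0 <= r by rewrite subr_ge0.
have -> : s = r + 1 by rewrite subrK.
rewrite GammaE//.
have ig := integrable_Gamma_integrand r r0.
have s12 : ([set` `[1, 2]] : set R) `<=` [set` `[0, +oo[].
  by move=> x /=; rewrite !in_itv/= andbT => /andP[x1 _]; rewrite (le_trans _ x1).
apply: (@lt_le_trans _ _ (expR (- 2))); first exact: expR_gt0.
rewrite -lee_fin /Rintegral fineK; last exact: integrable_fin_num.
apply: (@le_trans _ _ (\int[mu]_(t in `[1%R, 2%R]) (`|t| `^ r * expR (- 1 * t))%:E)%E); last first.
  apply: ge0_subset_integral => //.
  - by apply/measurable_EFinP; apply: measurable_funTS;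
      apply: continuous_measurable_fun; exact: continuous_Gamma_integrand.
apply: (@le_trans _ _ (\int[mu]_(t in `[1%R, 2%R]) (expR (- 2))%:E)%E).
  rewrite integral_cst//= lebesgue_measure_itv/= lte_fin ltr1n.
  by rewrite -EFinD -EFinM lee_fin; have := expR_gt0 (- 2 : R); lra.
apply: ge0_le_integral => //.
- by apply/measurable_EFinP; apply: measurable_funTS;
      apply: continuous_measurable_fun; exact: continuous_Gamma_integrand.
- move=> x /=; rewrite in_itv/= => /andP[x1 x2]; rewrite lee_fin.
  rewrite -[leLHS]mul1r ler_pM ?expR_ge0//; last by rewrite ler_expR; lra.
  rewrite ger0_norm ?(le_trans _ x1)//.
  have := @ge0_ler_powR R r r0 1 x; rewrite powR1 !nnegrE; apply => //.
  by rewrite (le_trans _ x1).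
Qed.

(** The difference of the two sides is [t^r (sqrt s - sqrt t)^2]. *)
Lemma powR_half_le s r t : 0 <= s -> 0 <= r -> 0 <= t ->
  2 * Num.sqrt s * t `^ (r + 2^-1) <= s * t `^ r + t `^ (r + 1).
Proof.
move=> s0 r0 t0; have [->|tn0] := eqVneq t 0.
  rewrite (@powR0 _ (r + 2^-1)) ?gt_eqF ?ltr_wpDl// mulr0.
  by rewrite addr_ge0 ?mulr_ge0 ?powR_ge0.
rewrite !powRD ?tn0 ?implybT// powRr1// powR12_sqrt//.
have -> : s * t `^ r + t `^ r * t =
    Num.sqrt s ^+ 2 * t `^ r + t `^ r * Num.sqrt t ^+ 2.
  by rewrite !sqr_sqrtr.
have := powR_ge0 t r.
move: (Num.sqrt s) (Num.sqrt t) (t `^ r) => x y z z0.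
rewrite -subr_ge0.
have -> : x ^+ 2 * z + z * y ^+ 2 - 2 * x * (z * y) = z * (x - y) ^+ 2 by ring.
by rewrite mulr_ge0 ?sqr_ge0.
Qed.

Lemma le_Rintegral_linear (f g h : R -> R) (x y : R) :
  mu.-integrable `[0, +oo[ (EFin \o f) -> mu.-integrable `[0, +oo[ (EFin \o g) ->
  mu.-integrable `[0, +oo[ (EFin \o h) ->
  (forall t, 0 <= t -> x * f t <= y * g t + h t) ->
  x * \int[mu]_(t in `[0, +oo[) f t <=
    y * \int[mu]_(t in `[0, +oo[) g t + \int[mu]_(t in `[0, +oo[) h t.
Proof.
move=> fi gi hi le_f.
have iZ (k : R) (l : R -> R) : mu.-integrable `[0, +oo[ (EFin \o l) ->
    mu.-integrable `[0, +oo[ (EFin \o (fun t => k * l t)).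
  move=> li; have /= := @integrableZl _ _ _ mu _ (measurable_itv _) k _ li.
  by apply: eq_integrable => // t _ /=; rewrite EFinM.
rewrite -!RintegralZl// -RintegralD//; last exact: iZ.
apply: le_Rintegral => //; first exact: iZ.
  have /= := @integrableD _ _ _ mu _ (measurable_itv _) _ _ (iZ y _ gi) hi.
  by apply: eq_integrable => // t _ /=; rewrite EFinD.
by move=> t /=; rewrite in_itv/= andbT; exact: le_f.
Qed.

(* AM-GM under the integral sign: [2 sqrt s t^(s-1/2) <= s t^(s-1) + t^s] *)
Lemma Gamma_half_le s : 1 <= s -> Gamma (s + 2^-1) <= Num.sqrt s * Gamma s.
Proof.
move=> s1; have s0 : 0 < s by rewrite (lt_le_trans ltr01).
have q0 : 0 < Num.sqrt s by rewrite sqrtr_gt0.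
suff : 2 * Num.sqrt s * Gamma (s + 2^-1) <= s * Gamma s + Gamma (s + 1).
  rewrite Gamma_rec//; move: (Gamma (s + 2^-1)) (Gamma s) => x y h.
  rewrite -(@ler_pM2l _ (2 * Num.sqrt s)) ?mulr_gt0//.
  have -> : 2 * Num.sqrt s * (Num.sqrt s * y) = Num.sqrt s ^+ 2 * y + Num.sqrt s ^+ 2 * y.
    by ring.
  by rewrite sqr_sqrtr ?(ltW s0).
have [r r0 sE] : exists2 r, 0 <= r & s = r + 1.
  by exists (s - 1); rewrite ?subr_ge0// subrK.
have s2E : s + 2^-1 = (r + 2^-1) + 1 by rewrite sE; ring.
have r10 : 0 <= r + 1 by rewrite addr_ge0.
have r20 : 0 <= r + 2^-1 by rewrite addr_ge0.
have e1 := GammaE _ r20; have e2 := GammaE _ r0; have e3 := GammaE _ r10.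
rewrite -s2E in e1; rewrite -sE in e2; rewrite -{1}sE in e3.
rewrite e1 e2 e3; clear e1 e2 e3 s2E sE.
apply: le_Rintegral_linear; [exact: integrable_Gamma_integrand..|].
move=> t t0; rewrite (ger0_norm t0) !mulrA -mulrDl.
by rewrite ler_wpM2r ?expR_ge0// powR_half_le// ltW.
Qed.

End GammaFunction.

(** * Moments of unit waves over a period *)

Section TrigonometricMoments.
Context {R : realType}.
Implicit Types (q t x d : R).
Notation mu := (@lebesgue_measure R).
Notation circle := (`[0, 2 * pi]%classic : set R).

Lemma Rintegral_derive (f F : R -> R) (a b : R) : a < b -> continuous f ->
  (forall x, is_derive x 1 F (f x)) ->
  \int[mu]_(x in `[a, b]) f x = F b - F a.
Proof.
move=> ab cf dF; rewrite /Rintegral (@continuous_FTC2 _ _ F)//.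
- exact: continuous_subspaceT.
- split.
  + by move=> x _; have [] := dF x.
  + by apply: cvg_at_right_filter; exact: is_derive_continuous (dF a).
  + by apply: cvg_at_left_filter; exact: is_derive_continuous (dF b).
- by move=> x _; rewrite derive1E; have [_ ->] := dF x.
Qed.

Lemma continuous_integrable_itv (f : R -> R) (a b : R) : continuous f ->
  mu.-integrable `[a, b] (EFin \o f).
Proof.
move=> cf; apply: continuous_compact_integrable; first exact: segment_compact.
exact: continuous_subspaceT.
Qed.

Lemma twopi_gt0 : 0 < 2 * pi :> R.
Proof. by rewrite mulr_gt0 ?pi_gt0. Qed.

Lemma cos_twopi : cos (2 * pi) = 1 :> R.
Proof. by rewrite mulr_natl cos2pi. Qed.

Lemma sin_twopi : sin (2 * pi) = 0 :> R.
Proof. by rewrite mulr_natl sin2pi. Qed.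

(** For a unit vector [(d1, d2) = (cos theta, sin theta)] this is [cos (t - theta)]. Coefficients
    instead of an angle keep the family visibly closed under differentiation and linear in the
    direction. *)
Definition wave (d1 d2 : R) t : R := d1 * cos t + d2 * sin t.

Lemma is_derive_wave (d1 d2 : R) t : is_derive t 1 (wave d1 d2) (wave d2 (- d1) t).
Proof.
have : is_derive t 1 (d1 \*: (@cos R) + d2 \*: (@sin R)) (wave d2 (- d1) t).
  apply: is_derive_eq; rewrite /wave /GRing.scale/=; ring.
by [].
Qed.

Lemma continuous_wave (d1 d2 : R) : continuous (wave d1 d2).
Proof. by move=> t; exact: is_derive_continuous (is_derive_wave d1 d2 t). Qed.

Lemma wave_sqrD (d1 d2 : R) t : d1 ^+ 2 + d2 ^+ 2 = 1 ->
  wave d1 d2 t ^+ 2 + wave d2 (- d1) t ^+ 2 = 1.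
Proof.
move=> d; have c := cos2Dsin2 t; rewrite /wave.
have -> : (d1 * cos t + d2 * sin t) ^+ 2 + (d2 * cos t + - d1 * sin t) ^+ 2 =
  (d1 ^+ 2 + d2 ^+ 2) * (cos t ^+ 2 + sin t ^+ 2) by ring.
by rewrite d c mulr1.
Qed.

Lemma norm_wave_le1 (d1 d2 : R) t : d1 ^+ 2 + d2 ^+ 2 = 1 -> `|wave d1 d2 t| <= 1.
Proof.
move=> /(wave_sqrD _ _ t) h; rewrite -(expr_le1 (n := 2))// real_normK ?num_real//.
by rewrite -h lerDl sqr_ge0.
Qed.

Definition wave_moment (d1 d2 : R) q : R := \int[mu]_(t in circle) `|wave d1 d2 t| `^ q.

Lemma continuous_wave_powR (d1 d2 : R) q : 0 <= q ->
  continuous (fun t => `|wave d1 d2 t| `^ q).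
Proof.
move=> q0 t; apply: (@continuous_comp _ _ _ (wave d1 d2) (fun x : R => `|x| `^ q)).
  exact: continuous_wave.
exact: continuous_abs_powR.
Qed.

Lemma integrable_wave_powR (d1 d2 : R) q : 0 <= q ->
  mu.-integrable circle (EFin \o (fun t => `|wave d1 d2 t| `^ q)).
Proof. by move=> q0; apply: continuous_integrable_itv; exact: continuous_wave_powR. Qed.

Lemma wave_moment_ge0 (d1 d2 : R) q : 0 <= wave_moment d1 d2 q.
Proof. by apply: Rintegral_ge0 => t _; exact: powR_ge0. Qed.

(** With [b'' = - b] and [b^2 + b'^2 = 1], the function [b' b |b|^q] has derivative
    [(q+1) |b|^q - (q+2) |b|^(q+2)]; by periodicity its increment over the circle vanishes. *)
Lemma wave_moment_rec (d1 d2 : R) q : d1 ^+ 2 + d2 ^+ 2 = 1 -> 0 <= q ->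
  (q + 2) * wave_moment d1 d2 (q + 2) = (q + 1) * wave_moment d1 d2 q.
Proof.
move=> d q0; have q20 : 0 <= q + 2 by rewrite addr_ge0.
pose b := wave d1 d2; pose b' := wave d2 (- d1).
pose f t := (q + 1) * `|b t| `^ q - (q + 2) * `|b t| `^ (q + 2).
pose F t := b' t * (b t * `|b t| `^ q).
have fI : \int[mu]_(t in circle) f t = F (2 * pi) - F 0.
  apply: Rintegral_derive; first exact: twopi_gt0.
    move=> t; apply: cvgB; (apply: cvgM; first exact: cvg_cst).
      exact: continuous_wave_powR.
    exact: continuous_wave_powR.
  move=> t; have db := is_derive_wave d1 d2 t; have db' := is_derive_wave d2 (- d1) t.
  have dh := is_derive_mul_abs_powR q (b t) q0.
  have dc := @is_derive1_comp R (fun y : R => y * `|y| `^ q) b t _ _ dh db.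
  have : is_derive t 1 (b' * ((fun y : R => y * `|y| `^ q) \o b)) (f t).
    apply: is_derive_eq; rewrite /GRing.scale/=.
    have -> : wave (- d1) (- d2) t = - b t by rewrite /b /wave; ring.
    rewrite /f powRD; last by rewrite gt_eqF ?ltr_wpDl.
    rewrite (powR_mulrn 2)// real_normK ?num_real// -/b'.
    have := wave_sqrD d1 d2 t d; rewrite -/b -/b'.
    move: (`|b t| `^ q) (b t) (b' t) => x y z h.
    have e : z ^+ 2 = 1 - y ^+ 2 by rewrite -h; ring.
    ring: e.
  by [].
have F0 : F (2 * pi) = F 0.
  by rewrite /F /b /b' /wave cos_twopi sin_twopi cos0 sin0.
move: fI; rewrite F0 subrr RintegralB//; last 2 first.
- apply: continuous_integrable_itv => t; apply: cvgM; first exact: cvg_cst.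
  exact: continuous_wave_powR.
- apply: continuous_integrable_itv => t; apply: cvgM; first exact: cvg_cst.
  exact: continuous_wave_powR.
rewrite !RintegralZl//; try exact: integrable_wave_powR.
by move=> /eqP; rewrite subr_eq0 => /eqP <-.
Qed.

Lemma wave_moment_nincr (d1 d2 : R) q q' : d1 ^+ 2 + d2 ^+ 2 = 1 -> 0 < q -> q <= q' ->
  wave_moment d1 d2 q' <= wave_moment d1 d2 q.
Proof.
move=> d q0 qq'; have q'0 := lt_le_trans q0 qq'.
apply: le_Rintegral => //; [exact/integrable_wave_powR/ltW..|].
move=> t _; have [->|b0] := eqVneq (wave d1 d2 t) 0.
  by rewrite normr0 !powR0 ?gt_eqF.
by apply: ger_powR => //; rewrite normr_gt0 b0 norm_wave_le1.
Qed.

(** The recursion at [q = 0], where the convention [0^0 = 1] makes the moment the length of the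
    circle. *)
Lemma wave_moment2 (d1 d2 : R) : d1 ^+ 2 + d2 ^+ 2 = 1 -> wave_moment d1 d2 2 = pi.
Proof.
move=> d; have := wave_moment_rec d1 d2 0 d (lexx _).
rewrite !add0r mul1r => h.
have h0 : wave_moment d1 d2 0 = 2 * pi.
  rewrite /wave_moment; under eq_Rintegral do rewrite powRr0.
  rewrite Rintegral_cst//= lebesgue_measure_itv/= lte_fin twopi_gt0.
  by rewrite -EFinD /= subr0 mul1r.
by apply: (@mulfI _ 2) => //; rewrite h h0.
Qed.

(** The one moment at an odd exponent that is computed directly; the sine is chosen because its sign
    is constant on [[0, pi]] and on [[pi, 2 pi]]. *)
Lemma wave_moment1_sin : wave_moment 0 1 1 = 4.
Proof.
have waveE t : `|wave 0 1 t| `^ 1 = `|sin t|.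
  by rewrite /wave mul0r add0r mul1r powRr1.
have cs : continuous (fun t : R => `|sin t|).
  move=> t; apply: (@continuous_comp _ _ _ (@sin R) (@Num.norm R R)).
    exact: continuous_sin.
  exact: norm_continuous.
rewrite /wave_moment; under eq_Rintegral do rewrite waveE.
have pi0 := pi_gt0 R.
have ics (a b : R) : mu.-integrable `[a, b] (EFin \o (fun t : R => `|sin t|)).
  exact: continuous_integrable_itv.
have h1 : \int[mu]_(t in `[0, pi]) `|sin t| = 2.
  under eq_Rintegral => t.
    rewrite inE/= in_itv/= => t0; rewrite ger0_norm ?sin_ge0_pi//; over.
  transitivity (- cos pi - - cos 0 : R); last by rewrite cospi cos0; ring.
  apply: (Rintegral_derive _ (fun t => - cos t)) => //.
  - exact: continuous_sin.
  - by move=> t; apply: is_derive_eq; rewrite opprK.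
have h2 : \int[mu]_(t in `[pi, 2 * pi]) `|sin t| = 2.
  under eq_Rintegral => t.
    rewrite inE/= in_itv/= => /andP[t1 t2].
    rewrite (_ : `|sin t| = - sin t); first over.
    rewrite ler0_norm// -[t](subrK pi) sinDpi oppr_le0 sin_ge0_pi//.
    by apply/andP; split; lra.
  transitivity (cos (2 * pi) - cos pi : R); last by rewrite cospi cos_twopi; ring.
  apply: (Rintegral_derive _ (@cos R)) => //.
  - lra.
  - by move=> t; apply: cvgN; exact: continuous_sin.
have := @Rintegral_itvB R (fun t => `|sin t|) (BLeft 0) (BRight (2 * pi)) pi (ics _ _).
rewrite !bnd_simp => /(_ (ltW pi0)) h; move: h.
rewrite Rintegral_itv_obnd_cbnd; last first.
  by apply: integrableS (ics pi (2 * pi)) => //; apply: subset_itvr; rewrite bnd_simp.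
rewrite h1 h2 => h; have {h} : \int[mu]_(t in circle) `|sin t| - 2 = 2 by apply: h; lra.
lra.
Qed.

End TrigonometricMoments.

(** * Rigidity of the two-step recursion *)

Section PeriodicRatio.
Context {R : realType}.
Implicit Types q x : R.

Lemma ler_of_linear_bound (x y c : R) :
  (forall k : nat, x * k%:R <= y * k%:R + c) -> x <= y.
Proof.
move=> h; rewrite leNgt; apply/negP => yx.
have xy0 : 0 < x - y by rewrite subr_gt0.
have c0 : 0 <= c by have := h 0%N; rewrite !mulr0 add0r.
have := archi_boundP (divr_ge0 c0 (ltW xy0)); set k := Num.bound _.
by rewrite ltr_pdivrMr// mulrBr => kc; have := h k; rewrite !(mulrC _ k%:R); lra.
Qed.

(* The ratio is 2-periodic, and [f] is squeezed between its values at the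
   neighbouring even integers, where the ratio is the one at [2]; the bounds
   [2 / (q + 1) <= g q ^+ 2 <= 2 / q] make the squeeze tight. *)
Lemma ratio_constant (f g : R -> R) :
  (forall q, 1 <= q -> 0 <= f q) ->
  (forall q q', 1 <= q -> q <= q' -> f q' <= f q) ->
  (forall q, 1 <= q -> (q + 2) * f (q + 2) = (q + 1) * f q) ->
  (forall q, 1 <= q -> 0 < g q) ->
  (forall q, 1 <= q -> (q + 2) * g (q + 2) = (q + 1) * g q) ->
  (forall q, 1 <= q -> 2 <= (q + 1) * g q ^+ 2) ->
  (forall q, 1 <= q -> q * g q ^+ 2 <= 2) ->
  forall q, 1 <= q -> f q / g q = f 2 / g 2.
Proof.
move=> f0 fn frec g_gt0 grec g_ge g_le; pose h q := f q / g q.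
have h0 q : 1 <= q -> 0 <= h q.
  by move=> q1; rewrite divr_ge0 ?f0 ?(ltW (g_gt0 q q1)).
have fE q : 1 <= q -> f q = h q * g q.
  by move=> q1; rewrite divfK// gt_eqF// g_gt0.
have hrec q : 1 <= q -> h (q + 2) = h q.
  move=> q1; have q21 : 1 <= q + 2 by lra.
  have e1 := frec q q1; have e2 := grec q q1.
  have g1 := g_gt0 q q1; have g2 := g_gt0 _ q21.
  have q2n : q + 2 != 0 by apply: lt0r_neq0; lra.
  rewrite /h; apply/eqP; rewrite eqr_div; [apply/eqP|by rewrite gt_eqF..].
  apply: (mulfI q2n); rewrite mulrA e1.
  by transitivity (f q * ((q + 2) * g (q + 2))); [rewrite e2|]; ring.
have hper (m : nat) q : 1 <= q -> h (q + 2 * m%:R) = h q.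
  move=> q1; elim: m => [|m IH]; first by rewrite mulr0 addr0.
  rewrite -IH -(hrec (q + 2 * m%:R)); last by have := ler0n R m; lra.
  by rewrite -(natr1 m); congr h; ring.
move=> q q1; rewrite -/(h q) -/(h 2).
have q20 : 0 <= q / 2 by lra.
have /andP[] := truncn_itv q20; move: (Num.truncn _) => j; rewrite -(natr1 j) => j1 j2.
(* Since [2j <= q < 2j + 2], the translate [p m] of [q] lies between the consecutive even numbers
   [n m] and [n m + 2]. The shift by 2 in both makes [n m] a translate of 2, even when [j = 0]. *)
pose n (m : nat) : R := 2 + 2 * (j + m)%:R.
pose p (m : nat) : R := q + 2 * m.+1%:R.
have n2 m : 2 <= n m by rewrite /n; have := ler0n R (j + m); lra.
have np m : n m <= p m.
  by rewrite /n /p natrD -(natr1 m); lra.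
have pn m : p m <= n m + 2.
  by rewrite /n /p natrD -(natr1 m); lra.
have n1 m : 1 <= n m by have := n2 m; lra.
have p1 m : 1 <= p m := le_trans (n1 m) (np m).
have hn m : h (n m) = h 2 by rewrite hper// ler1n.
have hn2 m : h (n m + 2) = h 2 by rewrite hrec.
have hp m : h (p m) = h q by rewrite hper.
have sq (x y u v : R) : 0 <= x -> 0 <= u -> 0 <= y -> 0 <= v -> x * u <= y * v ->
    x ^+ 2 * u ^+ 2 <= y ^+ 2 * v ^+ 2.
  by move=> *; rewrite -!exprMn ler_pXn2r// nnegrE mulr_ge0.
have gr0 x : 1 <= x -> 0 <= g x by move=> /g_gt0/ltW.
(* From [f (p m) <= f (n m)], squared, with [g (p m)^2 >= 2 / (p m + 1)], [g (n m)^2 <= 2 / n m] and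
   [p m + 1 <= n m + 3]. *)
have up m : h q ^+ 2 * n m <= h 2 ^+ 2 * (n m + 3).
  have fle := fn _ _ (n1 m) (np m); rewrite !fE// hp hn in fle.
  have {}fle := sq _ _ _ _ (h0 _ q1) (gr0 _ (p1 m)) (h0 _ (ler1n R 2)) (gr0 _ (n1 m)) fle.
  have l := g_ge _ (p1 m); have u := g_le _ (n1 m).
  have A0 := sqr_ge0 (h q); have B0 := sqr_ge0 (h 2).
  move: fle l u (np m) (pn m) (n1 m) A0 B0.
  move: (h q ^+ 2) (h 2 ^+ 2) (g (p m) ^+ 2) (g (n m) ^+ 2).
  move=> A B X Y; move: (n m) (p m) => nn pp fle l u np' pn' n1' A0 B0.
  have s1 : 2 * A <= (pp + 1) * (B * Y).
    apply: (@le_trans _ _ ((pp + 1) * (A * X))); last by rewrite ler_wpM2l//; lra.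
    by rewrite mulrCA (mulrC 2) ler_wpM2l.
  have s2 : (pp + 1) * (B * Y) * nn <= 2 * (B * (pp + 1)).
    have -> : (pp + 1) * (B * Y) * nn = (nn * Y) * (B * (pp + 1)) by ring.
    by rewrite ler_wpM2r// mulr_ge0//; lra.
  have s3 : 2 * A * nn <= (pp + 1) * (B * Y) * nn by rewrite ler_wpM2r//; lra.
  have s4 : B * (pp + 1) <= B * (nn + 3) by rewrite ler_wpM2l//; lra.
  lra.
(* The mirror estimate, from [f (n m + 2) <= f (p m)]. *)
have lo m : h 2 ^+ 2 * n m <= h q ^+ 2 * (n m + 3).
  have n21 : 1 <= n m + 2 by have := n1 m; lra.
  have fle := fn _ _ (p1 m) (pn m); rewrite !fE// hp hn2 in fle.
  have {}fle := sq _ _ _ _ (h0 _ (ler1n R 2)) (gr0 _ n21) (h0 _ q1) (gr0 _ (p1 m)) fle.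
  have l := g_ge _ n21; have u := g_le _ (p1 m).
  have A0 := sqr_ge0 (h q); have B0 := sqr_ge0 (h 2).
  move: fle l u (np m) (pn m) (n1 m) A0 B0.
  move: (h q ^+ 2) (h 2 ^+ 2) (g (n m + 2) ^+ 2) (g (p m) ^+ 2).
  move=> A B X Y; move: (n m) (p m) => nn pp fle l u np' pn' n1' A0 B0.
  have s1 : 2 * B <= (nn + 3) * (A * Y).
    apply: (@le_trans _ _ ((nn + 3) * (B * X))); last by rewrite ler_wpM2l//; lra.
    rewrite mulrCA (mulrC 2) ler_wpM2l//; lra.
  have s2 : (nn + 3) * (A * Y) * pp <= 2 * (A * (nn + 3)).
    have -> : (nn + 3) * (A * Y) * pp = (pp * Y) * (A * (nn + 3)) by ring.
    by rewrite ler_wpM2r// mulr_ge0//; lra.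
  have s3 : 2 * B * pp <= (nn + 3) * (A * Y) * pp by rewrite ler_wpM2r//; lra.
  have s4 : B * nn <= B * pp by rewrite ler_wpM2l.
  lra.
have A0 := sqr_ge0 (h q); have B0 := sqr_ge0 (h 2).
suff : h q ^+ 2 = h 2 ^+ 2.
  have := h0 q q1; have := h0 2 (ler1n R 2).
  by move: (h q) (h 2) => x y y0 x0 /eqP; rewrite eqrXn2// => /eqP.
apply/eqP; rewrite eq_le; apply/andP; split.
(* Here [n k + 3 = 2k + 2j + 5]; after halving, [j + 5] generously covers the part independent of
   [k]. *)
- apply: (@ler_of_linear_bound _ _ (h 2 ^+ 2 * (j%:R + 5))) => k.
  have := up k; rewrite /n natrD.
  have := mulr_ge0 A0 (ler0n R j); have := mulr_ge0 B0 (ler0n R j); lra.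
- apply: (@ler_of_linear_bound _ _ (h q ^+ 2 * (j%:R + 5))) => k.
  have := lo k; rewrite /n natrD.
  have := mulr_ge0 A0 (ler0n R j); have := mulr_ge0 B0 (ler0n R j); lra.
Qed.

End PeriodicRatio.

(** * The Gamma ratio and the closed form of the moments *)

Section GammaRatio.
Context {R : realType}.
Implicit Types (q x : R).

Definition gamma_ratio q : R := Gamma ((1 + q) / 2) / Gamma ((2 + q) / 2).

Let Gamma2_gt0 q : 1 <= q -> 0 < Gamma ((2 + q) / 2).
Proof. by move=> q1; apply: Gamma_gt0; lra. Qed.

Lemma gamma_ratio_gt0 q : 1 <= q -> 0 < gamma_ratio q.
Proof. by move=> q1; rewrite divr_gt0//; apply: Gamma_gt0; lra. Qed.

Lemma gamma_ratio_rec q : 1 <= q ->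
  (q + 2) * gamma_ratio (q + 2) = (q + 1) * gamma_ratio q.
Proof.
move=> q1; rewrite /gamma_ratio.
have -> : (1 + (q + 2)) / 2 = (1 + q) / 2 + 1 by field.
have -> : (2 + (q + 2)) / 2 = (2 + q) / 2 + 1 by field.
rewrite !Gamma_rec; [|lra..].
have /gt_eqF/negbT g0 := Gamma2_gt0 q q1.
have q2 : 2 + q != 0 by apply: lt0r_neq0; lra.
by field; rewrite g0.
Qed.

(** [Gamma_half_le] at [s = (1 + q) / 2] bounds the inverse of the ratio by [sqrt s]. *)
Lemma gamma_ratio_sqr_ge q : 1 <= q -> 2 <= (q + 1) * gamma_ratio q ^+ 2.
Proof.
move=> q1; have g0 := gamma_ratio_gt0 q q1.
have s1 : 1 <= (1 + q) / 2 by lra.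
have := Gamma_half_le _ s1.
have -> : (1 + q) / 2 + 2^-1 = (2 + q) / 2 by field.
rewrite -ler_pdivrMr; last exact: Gamma_gt0.
have -> : Gamma ((2 + q) / 2) / Gamma ((1 + q) / 2) = (gamma_ratio q)^-1.
  by rewrite /gamma_ratio invf_div.
rewrite -(@ler_pXn2r _ 2)// ?nnegrE ?invr_ge0 ?(ltW g0) ?sqrtr_ge0//.
rewrite sqr_sqrtr; last lra.
rewrite exprVn -[leLHS]mul1r ler_pdivrMr ?exprn_gt0//.
by move=> h; lra.
Qed.

(** [Gamma_half_le] at [s = (2 + q) / 2], combined with the functional equation, gives
    [(q+1)^2 g^2 <= 2 (q+2)] for the ratio [g]; then [q (q+2) <= (q+1)^2]. *)
Lemma gamma_ratio_sqr_le q : 1 <= q -> q * gamma_ratio q ^+ 2 <= 2.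
Proof.
move=> q1; have g0 := gamma_ratio_gt0 q q1.
have s1 : 1 <= (2 + q) / 2 by lra.
have := Gamma_half_le _ s1.
have -> : (2 + q) / 2 + 2^-1 = (1 + q) / 2 + 1 by field.
rewrite Gamma_rec; last lra.
rewrite -ler_pdivrMr; last exact: Gamma_gt0.
rewrite -(mulrA ((1 + q) / 2)) -/(gamma_ratio q).
rewrite -(@ler_pXn2r _ 2)// ?nnegrE ?sqrtr_ge0//; last by rewrite mulr_ge0 ?(ltW g0)//; lra.
rewrite sqr_sqrtr; last lra.
rewrite exprMn => h.
have : (q * (q + 2)) * gamma_ratio q ^+ 2 <= (q + 1) ^+ 2 * gamma_ratio q ^+ 2.
  by rewrite ler_wpM2r ?sqr_ge0//; nra.
have -> : (q + 1) ^+ 2 * gamma_ratio q ^+ 2 = 4 * (((1 + q) / 2) ^+ 2 * gamma_ratio q ^+ 2) by field.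
move=> h'; rewrite -(@ler_pM2l _ (q + 2)); last lra.
rewrite mulrA (mulrC (q + 2) q); lra.
Qed.

Lemma wave_moment_ratio (d1 d2 : R) q : d1 ^+ 2 + d2 ^+ 2 = 1 -> 1 <= q ->
  wave_moment d1 d2 q / gamma_ratio q = pi / gamma_ratio 2.
Proof.
move=> d q1; rewrite -(wave_moment2 d1 d2 d).
apply: (ratio_constant (wave_moment d1 d2) gamma_ratio _ _ _ gamma_ratio_gt0
  gamma_ratio_rec gamma_ratio_sqr_ge gamma_ratio_sqr_le q q1).
- by move=> *; exact: wave_moment_ge0.
- by move=> x y x1 xy; apply: wave_moment_nincr d _ xy; lra.
- by move=> x x1; apply: wave_moment_rec d _; lra.
Qed.

(** As [Gamma 2 = Gamma 1], the ratios at 1 and 2 are inverse to each other. The sine at [q = 1]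
    then gives [4 / g 1 = pi * g 1], hence [g 1 = 2 / sqrt pi], a value that transfers to every unit
    wave. *)
Lemma wave_momentE (d1 d2 : R) q : d1 ^+ 2 + d2 ^+ 2 = 1 -> 1 <= q ->
  (2 * pi)^-1 * wave_moment d1 d2 q =
  Gamma ((1 + q) / 2) / (Num.sqrt pi * Gamma ((2 + q) / 2)).
Proof.
move=> d q1; have pi0 := pi_gt0 R.
have g1 := gamma_ratio_gt0 1 (lexx _).
have g2E : gamma_ratio 2 = (gamma_ratio 1)^-1.
  rewrite /gamma_ratio invf_div; congr (Gamma _ / _); first by field.
  have -> : (2 + 2) / 2 = 1 + 1 :> R by field.
  by rewrite Gamma_rec// mul1r; congr Gamma; field.
have dsin : 0 ^+ 2 + 1 ^+ 2 = 1 :> R by ring.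
have e := wave_moment_ratio _ _ _ dsin (lexx 1).
rewrite wave_moment1_sin g2E invrK in e.
have sp0 : 0 < Num.sqrt pi :> R by rewrite sqrtr_gt0.
have sE : Num.sqrt pi ^+ 2 = pi :> R by rewrite sqr_sqrtr ?ltW.
have {}e : gamma_ratio 1 = 2 / Num.sqrt pi.
  have {}e : gamma_ratio 1 ^+ 2 = (2 / Num.sqrt pi) ^+ 2.
    rewrite [in RHS]exprMn exprVn sE; apply: (@mulfI _ pi); first by rewrite gt_eqF.
    rewrite [in RHS]mulrCA mulfV ?gt_eqF// mulr1 -natrX.
    by rewrite expr2 mulrA -e divfK// gt_eqF.
  have r0 : 0 <= 2 / Num.sqrt pi :> R by rewrite divr_ge0 ?(ltW sp0).
  by move/eqP : e; rewrite eqrXn2 ?(ltW g1)// => /eqP.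
have gq := gamma_ratio_gt0 q q1.
have := wave_moment_ratio d1 d2 q d q1.
rewrite g2E invrK e => /(canRL (mulfVK _)) ->; last by rewrite gt_eqF.
have G2 := Gamma2_gt0 q q1.
rewrite /gamma_ratio; move: sp0 pi0; move: (Num.sqrt pi) => S; move: (pi : R) => P S0 P0.
by field; rewrite !gt_eqF.
Qed.

End GammaRatio.

(** * Differentiating the kernel integral at the origin *)

Section PoissonKernel.
Context {R : realType}.
Implicit Types (a h x r s t : R).
Notation mu := (@lebesgue_measure R).
Notation circle := (`[0, 2 * pi]%classic : set R).

(** The exponent may have either sign, so the power is largest at one end or the other; the sum of
    the two end values covers both cases. *)
Lemma powR_itv_le (m M r x : R) : 0 < m -> m <= x -> x <= M ->
  x `^ r <= m `^ r + M `^ r.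
Proof.
move=> m0 mx xM; have x0 := lt_le_trans m0 mx; have M0 := lt_le_trans x0 xM.
have [r0|/ltW r0] := leP 0 r.
  apply: (@le_trans _ _ (M `^ r)); last by rewrite lerDr powR_ge0.
  by rewrite ge0_ler_powR// nnegrE ltW.
apply: (@le_trans _ _ (m `^ r)); last by rewrite lerDl powR_ge0.
rewrite -(opprK r) powRN (powRN m) lef_pV2 ?posrE ?powR_gt0//.
by rewrite ge0_ler_powR ?oppr_ge0// nnegrE ltW.
Qed.

(* [K_alpha] over [c_alpha] at a point of modulus [|h|] and real part [h * x] *)
Definition kernel a h x : R :=
  (1 - h ^+ 2) `^ (a + 1) * (1 - 2 * h * x + h ^+ 2) `^ (- ((a + 2) / 2)).

Lemma K_alphaE a h x (X Y : R) : X = h * x -> X ^+ 2 + Y ^+ 2 = h ^+ 2 ->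
  K_alpha a X Y = c_alpha a * kernel a h x.
Proof.
move=> XE XY; rewrite /K_alpha /kernel XY mulrA; congr (_ * _).
have -> : (1 - X) ^+ 2 + Y ^+ 2 = 1 - 2 * h * x + h ^+ 2 by rewrite -XY XE; ring.
have D0 : 0 <= 1 - 2 * h * x + h ^+ 2.
  suff -> : 1 - 2 * h * x + h ^+ 2 = (1 - X) ^+ 2 + Y ^+ 2.
    by rewrite addr_ge0 ?sqr_ge0.
  by rewrite -XY XE; ring.
by rewrite -powR12_sqrt// -powRrM powRN; congr (_ `^ _)^-1; field.
Qed.

(** The derivative of [kernel] in [h], written out so that it can be bounded uniformly. At [h = 0]
    it collapses to [(a + 2) * x]. *)
Definition kernel' a h x : R :=
  - (2 * (a + 1)) * h * ((1 - h ^+ 2) `^ a * (1 - 2 * h * x + h ^+ 2) `^ (- ((a + 2) / 2))) +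
  (a + 2) * (x - h) * ((1 - h ^+ 2) `^ (a + 1) * (1 - 2 * h * x + h ^+ 2) `^ (- ((a + 2) / 2) - 1)).

(** Radius [1/2] keeps both bases in a compact part of the positive axis, where powers of any real
    exponent are differentiable and bounded. *)
Lemma kernel_base_bounds h x : `|h| < 2^-1 -> `|x| <= 1 ->
  3 / 4 <= 1 - h ^+ 2 <= 1 /\ 1 / 4 <= 1 - 2 * h * x + h ^+ 2 <= 3.
Proof.
move=> h1 x1; have n0 := normr_ge0 h.
have : `|h * x| <= `|h| by rewrite normrM ler_piMr.
rewrite ler_norml => /andP[hx1 hx2].
have -> : h ^+ 2 = `|h| ^+ 2 by rewrite real_normK ?num_real.
rewrite -(mulrA 2 h x); move: hx1 hx2 h1 n0; move: (h * x) `|h| => y n *.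
by split; apply/andP; split; nra.
Qed.

Lemma is_derive_kernel a h x : `|h| < 2^-1 -> `|x| <= 1 ->
  is_derive h 1 (fun h => kernel a h x) (kernel' a h x).
Proof.
move=> hh hx; have [/andP[A0 _] /andP[B0 _]] := kernel_base_bounds h x hh hx.
have {}A0 : 0 < 1 - h ^+ 2 by lra.
have {}B0 : 0 < 1 - 2 * h * x + h ^+ 2 by lra.
have dA : is_derive h 1 (fun h : R => 1 - h ^+ 2) (- (2 * h)).
  have : is_derive h 1 ((cst 1 : R -> R) - (id : R -> R) ^+ 2) (- (2 * h)).
    by apply: is_derive_eq; rewrite /GRing.scale/=; ring.
  by [].
have dB : is_derive h 1 (fun h : R => 1 - 2 * h * x + h ^+ 2) (2 * h - 2 * x).
  have : is_derive h 1 ((cst 1 : R -> R) - (2 * x) \*: (id : R -> R) + (id : R -> R) ^+ 2) (2 * h - 2 * x).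
    by apply: is_derive_eq; rewrite /GRing.scale/=; ring.
  rewrite (_ : (_ + _ : R -> R) = (fun h : R => 1 - 2 * h * x + h ^+ 2))//.
  apply/funext => y; rewrite !fctE.
  by rewrite -[LHS]/(1 - 2 * x * y + y ^+ 2); ring.
have pA := is_derive1_powR (a + 1) A0.
have pB := is_derive1_powR (- ((a + 2) / 2)) B0.
have cA := @is_derive1_comp R _ (fun h : R => 1 - h ^+ 2) h _ _ pA dA.
have cB := @is_derive1_comp R _ (fun h : R => 1 - 2 * h * x + h ^+ 2) h _ _ pB dB.
have : is_derive h 1
  ((@powR R ^~ (a + 1) \o (fun h : R => 1 - h ^+ 2)) *
   (@powR R ^~ (- ((a + 2) / 2)) \o (fun h : R => 1 - 2 * h * x + h ^+ 2))) (kernel' a h x).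
  by apply: is_derive_eq; rewrite /kernel' /GRing.scale/= addrK; field.
by [].
Qed.

(** One constant serves twice: for the kernel it gives integrability of the integrand, for its
    derivative the domination needed under the integral sign. *)
Lemma kernel_bound a : exists2 M : R, 0 < M & forall h x,
  `|h| < 2^-1 -> `|x| <= 1 -> `|kernel a h x| <= M /\ `|kernel' a h x| <= M.
Proof.
pose PA (r : R) : R := (3 / 4) `^ r + 1 `^ r; pose PB (r : R) : R := (1 / 4) `^ r + 3 `^ r.
have PA0 r : 0 <= PA r by rewrite addr_ge0 ?powR_ge0.
have PB0 r : 0 <= PB r by rewrite addr_ge0 ?powR_ge0.
pose s := - ((a + 2) / 2).
pose M1 := PA (a + 1) * PB s.
pose M2 := `|2 * (a + 1)| * (PA a * PB s) + `|a + 2| * 2 * (PA (a + 1) * PB (s - 1)).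
have M10 : 0 <= M1 by rewrite mulr_ge0.
have M20 : 0 <= M2.
  by rewrite addr_ge0 ?mulr_ge0.
exists (1 + M1 + M2); first by lra.
move=> h x hh hx; have [/andP[A0 A1] /andP[B0 B1]] := kernel_base_bounds h x hh hx.
have bA r : (1 - h ^+ 2) `^ r <= PA r by apply: powR_itv_le => //; lra.
have bB r : (1 - 2 * h * x + h ^+ 2) `^ r <= PB r by apply: powR_itv_le => //; lra.
have bAB r r' : `|(1 - h ^+ 2) `^ r * (1 - 2 * h * x + h ^+ 2) `^ r'| <= PA r * PB r'.
  by rewrite ger0_norm ?mulr_ge0 ?powR_ge0// ler_pM ?powR_ge0.
split; first by apply: le_trans (bAB _ _) _; rewrite -/M1; lra.
apply: (@le_trans _ _ M2); last by lra.
apply: le_trans (ler_normD _ _) _; rewrite normrM [in X in _ + X]normrM; apply: lerD.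
  apply: ler_pM => //.
  rewrite normrM normrN -[leRHS]mulr1 ler_wpM2l//.
  by rewrite (le_trans (ltW hh))//; lra.
apply: ler_pM => //; rewrite normrM ler_wpM2l//.
by apply: le_trans (ler_normB _ _) _; lra.
Qed.

Lemma measurable_kernel a h (b : R -> R) : measurable_fun setT b ->
  measurable_fun setT (fun t => kernel a h (b t)).
Proof.
move=> mb; apply: measurable_funM => //.
apply: (@measurableT_comp _ _ _ _ _ _ (@powR R ^~ (- ((a + 2) / 2)))) => //.
apply: measurable_funD => //; apply: measurable_funB => //.
exact: measurable_funM.
Qed.

Lemma integrable_bounded_mul (b g : R -> R) (M : R) :
  measurable_fun circle b -> (forall t, circle t -> `|b t| <= M) ->
  mu.-integrable circle (EFin \o g) ->
  mu.-integrable circle (EFin \o (fun t => b t * g t)).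
Proof.
move=> mb bM ig; have mg : measurable_fun circle g.
  by have /integrableP[/measurable_EFinP] := ig.
apply: (@le_integrable _ _ _ mu _ _ _ (fun t => (M%:E * (EFin \o g) t)%E)) => //.
- by apply/measurable_EFinP; exact: measurable_funM.
- move=> t ct /=; rewrite lee_fin !normrM ler_wpM2r//.
  by apply: le_trans (bM t ct) (ler_norm _).
- exact: integrableZl.
Qed.

(** Domination by [|c| M |g|] on [|h| < 1/2]. The function [b] stays general because the two partial
    derivatives use it with [cos] and with [sin]. *)
Lemma derive_kernel_integral a (c : R) (b g : R -> R) :
  measurable_fun setT b -> (forall t, `|b t| <= 1) ->
  mu.-integrable circle (EFin \o g) ->
  derive1 (fun h => (2 * pi)^-1 * \int[mu]_(t in circle) (c * kernel a h (b t) * g t)) 0 =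
  (a + 2) * c * ((2 * pi)^-1 * \int[mu]_(t in circle) (b t * g t)).
Proof.
move=> mb b1 ig; have [M M0 hM] := kernel_bound a.
pose f h t := c * kernel a h (b t) * g t.
have Ih h : h \in `](- 2^-1), 2^-1[ -> `|h| < 2^-1 by rewrite in_itv/= ltr_norml.
have dfh h t : h \in `](- 2^-1), 2^-1[ ->
    is_derive h 1 (f ^~ t) (c * kernel' a h (b t) * g t).
  move=> /Ih hh; have dk := is_derive_kernel a h (b t) hh (b1 t).
  have : is_derive h 1 ((c * g t) \*: (fun h => kernel a h (b t))) (c * kernel' a h (b t) * g t).
    by apply: is_derive_eq; rewrite /GRing.scale/=; ring.
  rewrite (_ : (_ \*: _) = f ^~ t)//.
  apply/funext => y; rewrite /f /=.
  by rewrite -[LHS]/(c * g t * kernel a y (b t)); ring.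
have I0 : 0 \in `](- 2^-1 : R), 2^-1[ by rewrite in_itv/= oppr_lt0 invr_gt0 ltr0n.
have intf h : h \in `](- 2^-1), 2^-1[ -> mu.-integrable circle (EFin \o f h).
  move=> /Ih hh; apply: (integrable_bounded_mul _ _ (`|c| * M)) => //.
    by apply: measurable_funM => //; apply: measurable_funTS; exact: measurable_kernel.
  by move=> t _; rewrite normrM ler_wpM2l//; have [] := hM h (b t) hh (b1 t).
have df h t : h \in `](- 2^-1), 2^-1[ -> circle t -> derivable (f ^~ t) h 1.
  by move=> hh _; have [] := dfh h t hh.
have G0 t : 0 <= `|c| * M * `|g t| by rewrite !mulr_ge0// ltW.
have iG : mu.-integrable circle (EFin \o (fun t => `|c| * M * `|g t|)).
  apply: (integrable_bounded_mul _ _ (`|c| * M)) => //.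
    by move=> t _; rewrite [leLHS]ger0_norm ?mulr_ge0 ?(ltW M0).
  exact: integrable_norm.
have Gub h t : h \in `](- 2^-1), 2^-1[ -> circle t ->
    `|partial1of2 f h t| <= `|c| * M * `|g t|.
  move=> hh _; rewrite partial1of2E; have [_ ->] := dfh h t hh.
  rewrite !normrM ler_wpM2r// ler_wpM2l//.
  by have [] := hM h (b t) (Ih h hh) (b1 t).
have mc : measurable circle by exact: measurable_itv.
have D1 := @derivable_under_integral R _ _ mu f circle mc 0 _ _ I0 intf df _ G0 iG Gub.
have D2 := @differentiation_under_integral R _ _ mu f circle mc 0 _ _ I0 intf df _ G0 iG Gub.
rewrite -[X in derive1 X](_ : (2 * pi)^-1 \*: (fun h => \int[mu]_(t in circle) f h t) = _)//.
rewrite derive1E deriveZ// -derive1E D2 /GRing.scale/= mulrCA; congr (_ * _).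
rewrite -RintegralZl//; last first.
  apply: (integrable_bounded_mul _ _ 1) => //; exact: measurable_funTS.
apply: eq_Rintegral => t _; rewrite partial1of2E; have [_ ->] := dfh 0 t I0.
rewrite /kernel' expr0n/= !mulr0 !mul0r !(subr0, addr0, add0r) powR1; ring.
Qed.

End PoissonKernel.

(** * Hoelder's inequality on the circle with normalised norms *)

Section Hoelder.
Context {R : realType}.
Notation mu := (@lebesgue_measure R).
Notation circle := (`[0, 2 * pi]%classic : set R).

(** Extension by zero adds nothing to the norm because [0^r = 0] for [r != 0]. *)
Lemma Lnorm_restrict (D : set R) (f : R -> R) (r : R) : r != 0 ->
  (Lnorm mu r%:E (EFin \o f \_ D) =
   (\int[mu]_(t in D) (`|f t| `^ r)%:E) `^ r^-1)%E.
Proof.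
move=> r0; rewrite unlock [in RHS]integral_mkcond; congr (_ `^ _)%E.
apply: eq_integral => x _; rewrite /= !patchE.
by case: ifPn => // _; rewrite normr0 powR0.
Qed.

Lemma hoelder_on (D : set R) (f g : R -> R) (p q : R) : measurable D ->
  measurable_fun D f -> measurable_fun D g -> 0 < p -> 0 < q -> p^-1 + q^-1 = 1 ->
  (\int[mu]_(t in D) `|f t * g t|%:E <=
   (\int[mu]_(t in D) (`|f t| `^ p)%:E) `^ p^-1 *
   (\int[mu]_(t in D) (`|g t| `^ q)%:E) `^ q^-1)%E.
Proof.
move=> mD mf mg p0 q0 pq.
have mf' := (measurable_restrictT f mD).1 mf.
have mg' := (measurable_restrictT g mD).1 mg.
have := hoelder mu mf' mg' p0 q0 pq.
rewrite !Lnorm_restrict ?gt_eqF//; apply: le_trans.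
rewrite Lnorm1 [leLHS]integral_mkcond le_eqVlt; apply/orP; left; apply/eqP.
apply: eq_integral => x _; rewrite /= !patchE.
by case: ifPn => // _; rewrite mulr0 normr0.
Qed.

Lemma Tnorm_ge0 (p : \bar R) (w : R -> R) : (0 <= Tnorm p w)%E.
Proof.
case: p => [r||]//=; first exact: poweR_ge0.
apply: ess_sup_gee; last by apply: nearW => t; rewrite lee_fin.
rewrite /= /mrestr setTI lebesgue_measure_itv/= lte_fin twopi_gt0.
by rewrite -EFinD subr0 lte_fin twopi_gt0.
Qed.

Lemma ae_le_Tnormy (w : R -> R) :
  {ae mu, forall t, circle t -> (`|w t|%:E <= Tnorm +oo w)%E}.
Proof.
have [A [mA A0 sA]] := ess_sup_ge (mrestr mu (measurable_itv `[0, 2 * pi])) (fun t => `|w t|%:E).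
exists (A `&` circle); split => //; first exact: measurableI.
move=> t /= /not_implyP[ct wt]; split => //; exact: sA.
Qed.

Lemma conj_exp_ge1 (p : \bar R) : (1 < p)%E -> 1 <= conj_exp p.
Proof.
case: p => [r||]//=; rewrite lte_fin => r1.
by rewrite ler_pdivlMr ?subr_gt0// mul1r gerBl.
Qed.

(** For finite [p] the weight [k = 1 / (2 pi)] is distributed as [k^(1/q) k^(1/p)] over the two
    factors. For [p = +oo], where [q = 1], the almost everywhere bound of [|w|] by its essential
    supremum is integrated against [|b|]. *)
Lemma hoelder_circle (p : \bar R) (b w : R -> R) : (1 < p)%E ->
  measurable_fun circle b -> (forall t, `|b t| <= 1) ->
  measurable_fun circle w -> (Tnorm p w < +oo)%E ->
  ((2 * pi)^-1%:E * \int[mu]_(t in circle) `|b t * w t|%:E <=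
   (((2 * pi)^-1 * \int[mu]_(t in circle) (`|b t| `^ conj_exp p)) `^ (conj_exp p)^-1)%:E
   * Tnorm p w)%E.
Proof.
move=> p1 mb b1 mw wy; have q1 := conj_exp_ge1 p p1.
set q := conj_exp p in q1 *; set k := (2 * pi)^-1.
have k0 : 0 <= k by rewrite invr_ge0 ltW ?twopi_gt0.
have q0 : 0 < q := lt_le_trans ltr01 q1.
have mbq : measurable_fun circle (fun t => `|b t| `^ q).
  apply: (@measurableT_comp _ _ _ _ _ _ (@powR R ^~ q)) => //.
  exact: measurableT_comp.
have ibq : mu.-integrable circle (EFin \o (fun t => `|b t| `^ q)).
  have i1 : mu.-integrable circle (EFin \o (fun=> 1 : R)).
    by apply: continuous_integrable_itv => t; exact: cvg_cst.
  have := integrable_bounded_mul (fun t => `|b t| `^ q) (fun=> 1) 1 mbq _ i1.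
  rewrite (_ : (fun t => `|b t| `^ q * 1) = (fun t => `|b t| `^ q)); last first.
    by apply/funext => t; rewrite mulr1.
  apply => t _; rewrite ger0_norm ?powR_ge0//.
  have := @ge0_ler_powR R q (ltW q0) `|b t| 1; rewrite powR1 !nnegrE; exact.
have IE : (\int[mu]_(t in circle) (`|b t| `^ q)%:E)%E =
    (\int[mu]_(t in circle) (`|b t| `^ q))%:E.
  by rewrite /Rintegral fineK//; apply: integrable_fin_num.
have I0 : 0 <= \int[mu]_(t in circle) (`|b t| `^ q).
  by apply: Rintegral_ge0 => t _; exact: powR_ge0.
case: p p1 wy @q q1 q0 mbq ibq IE I0 => [r||]//= r1 wy q1 q0 mbq ibq IE I0.
- rewrite lte_fin in r1; have r0 : 0 < r := lt_trans ltr01 r1.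
  set q := r / (r - 1) in q1 q0 mbq ibq IE I0 *.
  have qr : q^-1 + r^-1 = 1.
    by rewrite /q invf_div; field; rewrite gt_eqF.
  have := hoelder_on _ _ _ _ _ (measurable_itv `[0, 2 * pi]) mb mw q0 r0 qr.
  move=> /(lee_wpmul2l (x := k%:E)); rewrite lee_fin => /(_ k0) /le_trans; apply.
  rewrite IE poweRM ?lee_fin//; last by apply: integral_ge0 => t _; rewrite lee_fin powR_ge0.
  rewrite !poweR_EFin powRM// [in X in (_ <= X)%E]EFinM.
  rewrite muleACA -EFinM -powRD ?qr ?oner_eq0//.
  by rewrite powRr1.
- rewrite invr1 powRr1; last by rewrite mulr_ge0.
  have N0 := Tnorm_ge0 +oo w; rewrite /= in N0.
  have := ae_le_Tnormy w; rewrite /=.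
  move: N0 wy; case: (ess_sup _ _) => [N||]// N0 _ wN.
  rewrite lee_fin in N0.
  rewrite EFinM -muleA lee_wpmul2l ?lee_fin//.
  under [in leRHS]eq_Rintegral do rewrite powRr1//.
  have IE' : (\int[mu]_(t in circle) `|b t|%:E)%E = (\int[mu]_(t in circle) `|b t|)%:E.
    transitivity (\int[mu]_(t in circle) (`|b t| `^ 1)%:E)%E.
      by apply: eq_integral => t _; rewrite powRr1.
    by rewrite IE; congr EFin; apply: eq_Rintegral => t _; rewrite powRr1.
  rewrite -IE' muleC -ge0_integralZl_EFin//; last first.
    by apply/measurable_EFinP; exact: measurableT_comp.
  apply: ae_ge0_le_integral => //.
  + by apply/measurable_EFinP; apply: measurableT_comp => //; exact: measurable_funM.
  + by move=> t _; rewrite mule_ge0 ?lee_fin.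
  + by apply: measurable_funeM; apply/measurable_EFinP; exact: measurableT_comp.
  + apply: (@filterS _ _ (ae_filter_ringOfSetsType mu) _ _ _ wN) => t {}wN ct.
    rewrite -EFinM lee_fin normrM mulrC ler_wpM2r//.
    by have := wN ct; rewrite lee_fin.
Qed.

(** Hoelder's inequality against the constant 1. *)
Lemma Tnorm_integrable (p : \bar R) (w : R -> R) : (1 < p)%E ->
  measurable_fun circle w -> (Tnorm p w < +oo)%E ->
  mu.-integrable circle (EFin \o w).
Proof.
move=> p1 mw wy; apply/integrableP; split; first exact/measurable_EFinP.
have k0 : 0 < (2 * pi)^-1 :> R by rewrite invr_gt0 twopi_gt0.
have := hoelder_circle p (fun=> 1) w p1 _ _ mw wy.
move=> /(_ (measurable_cst _)) h; have {h} := h (fun=> _).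
rewrite normr1 lexx => /(_ isT) h.
have : ((2 * pi)^-1%:E * \int[mu]_(t in circle) `|1 * w t|%:E < +oo)%E.
  by apply: le_lt_trans h _; rewrite lte_mul_pinfty ?lee_fin ?powR_ge0.
under eq_integral do rewrite mul1r.
have : (0 <= \int[mu]_(t in circle) `|w t|%:E)%E.
  by apply: integral_ge0 => t _; rewrite lee_fin.
rewrite (_ : (\int[mu]_(t in circle) `|(EFin \o w) t|)%E = (\int[mu]_(t in circle) `|w t|%:E)%E)//.
case: (\int[mu]_(_ in _) _)%E => [r _ _||]//; first by rewrite ltry.
by move=> _; rewrite gt0_muley ?lte_fin.
Qed.

End Hoelder.

(** * The Wirtinger form of the operator norm *)

Section OperatorNorm.
Context {R : realType}.
Implicit Types x y : R.

Lemma unit_vector_aligned x y : exists e1 e2 : R,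
  e1 ^+ 2 + e2 ^+ 2 = 1 /\ Num.sqrt (x ^+ 2 + y ^+ 2) = e1 * x + e2 * y.
Proof.
set n := Num.sqrt _; have n2 : n ^+ 2 = x ^+ 2 + y ^+ 2.
  by rewrite sqr_sqrtr// addr_ge0 ?sqr_ge0.
have [n0|n0] := eqVneq n 0.
  exists 1, 0; split; first by ring.
  have /eqP := n2; rewrite n0 expr0n/= eq_sym paddr_eq0 ?sqr_ge0// !sqrf_eq0.
  by move=> /andP[/eqP-> /eqP->]; rewrite !mulr0 addr0.
exists (x / n), (y / n); split.
  by rewrite !exprMn -mulrDl -n2 exprVn mulfV// expf_neq0.
by rewrite mulrAC (mulrAC y) -mulrDl -!expr2 -n2 expr2 mulfK.
Qed.

(** A square root of the unit complex number [x + i y]: the half-angle formulas with [d1 >= 0], the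
    sign of [y] being carried by [d2]. *)
Lemma unit_vector_half_angle x y : x ^+ 2 + y ^+ 2 = 1 -> exists d1 d2 : R,
  [/\ d1 ^+ 2 = (1 + x) / 2, d2 ^+ 2 = (1 - x) / 2 & d1 * d2 = y / 2].
Proof.
move=> xy; have x1 : `|x| <= 1.
  rewrite -(expr_le1 (n := 2))// real_normK ?num_real//.
  by rewrite -xy lerDl sqr_ge0.
have /andP[x1' x1''] : -1 <= x <= 1 by rewrite -ler_norml.
pose d1 := Num.sqrt ((1 + x) / 2); pose d2 := Num.sqrt ((1 - x) / 2).
have d1E : d1 ^+ 2 = (1 + x) / 2 by rewrite sqr_sqrtr//; lra.
have d2E : d2 ^+ 2 = (1 - x) / 2 by rewrite sqr_sqrtr//; lra.
have dE : d1 * d2 = `|y| / 2.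
  apply/eqP; rewrite -(@eqrXn2 _ 2)// ?mulr_ge0 ?sqrtr_ge0//.
  rewrite !exprMn d1E d2E real_normK ?num_real//; apply/eqP.
  have -> : y ^+ 2 = 1 - x ^+ 2 by rewrite -xy; ring.
  by field.
have [y0|y0] := leP 0 y.
  by exists d1, d2; split => //; rewrite dE ger0_norm.
exists d1, (- d2); split => //; first by rewrite sqrrN.
by rewrite mulrN dE ltr0_norm// mulNr opprK.
Qed.

(** In complex notation [Dw d = w_z d + w_zbar conj(d)]. With [a] and [b] the unit directions of
    [w_z] and [w_zbar], the two terms are aligned when [a d = b conj(d)], that is
    [d^2 = b conj(a) = X + i Y]; their common direction is [e = a d]. *)
Lemma operator_norm_attained (ux uy vx vy : R) : exists d1 d2 e1 e2 : R,
  [/\ d1 ^+ 2 + d2 ^+ 2 = 1, e1 ^+ 2 + e2 ^+ 2 = 1 &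
    Num.sqrt ((ux + vy) ^+ 2 + (vx - uy) ^+ 2) / 2
    + Num.sqrt ((ux - vy) ^+ 2 + (vx + uy) ^+ 2) / 2 =
    e1 * (d1 * ux + d2 * uy) + e2 * (d1 * vx + d2 * vy)].
Proof.
have [a1 [a2 [aa ->]]] := unit_vector_aligned (ux + vy) (vx - uy).
have [b1 [b2 [bb ->]]] := unit_vector_aligned (ux - vy) (vx + uy).
pose X := a1 * b1 + a2 * b2; pose Y := a1 * b2 - a2 * b1.
have XY : X ^+ 2 + Y ^+ 2 = 1.
  have -> : X ^+ 2 + Y ^+ 2 = (a1 ^+ 2 + a2 ^+ 2) * (b1 ^+ 2 + b2 ^+ 2).
    by rewrite /X /Y; ring.
  by rewrite aa bb mulr1.
have [d1 [d2 [d11 d22 d12]]] := unit_vector_half_angle X Y XY.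
have dd : d1 ^+ 2 + d2 ^+ 2 = 1 by rewrite d11 d22; field.
have b1E : a1 * X - a2 * Y = b1.
  by rewrite -[RHS]mul1r -aa /X /Y; ring.
have b2E : a2 * X + a1 * Y = b2.
  by rewrite -[RHS]mul1r -aa /X /Y; ring.
exists d1, d2, (a1 * d1 - a2 * d2), (a1 * d2 + a2 * d1); split => //.
  have -> : (a1 * d1 - a2 * d2) ^+ 2 + (a1 * d2 + a2 * d1) ^+ 2 =
    (a1 ^+ 2 + a2 ^+ 2) * (d1 ^+ 2 + d2 ^+ 2) by ring.
  by rewrite aa dd mulr1.
transitivity ((a1 * d1 ^+ 2 - a2 * (d1 * d2)) * ux + (a1 * (d1 * d2) - a2 * d2 ^+ 2) * uy
  + (a1 * (d1 * d2) + a2 * d1 ^+ 2) * vx + (a1 * d2 ^+ 2 + a2 * (d1 * d2)) * vy); last by ring.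
by rewrite d11 d22 d12 -b1E -b2E; field.
Qed.

(** Here [ux] is half the sum of [ux + vy] and [ux - vy]. For sharpness a single partial derivative
    therefore suffices. *)
Lemma ler_wirtinger_sum (ux uy vx vy : R) :
  ux <= Num.sqrt ((ux + vy) ^+ 2 + (vx - uy) ^+ 2) / 2
    + Num.sqrt ((ux - vy) ^+ 2 + (vx + uy) ^+ 2) / 2.
Proof.
have le_sqrt x y : x <= Num.sqrt (x ^+ 2 + y ^+ 2).
  by rewrite (le_trans (ler_norm _))// -sqrtr_sqr ler_wsqrtr// lerDl sqr_ge0.
have := le_sqrt (ux + vy) (vx - uy); have := le_sqrt (ux - vy) (vx + uy); lra.
Qed.

End OperatorNorm.

Lemma DnormE {R : realType} (u v : R -> R -> R) (x y ux uy vx vy : R) :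
  derive1 (fun h => u h y) x = ux -> derive1 (fun h => u x h) y = uy ->
  derive1 (fun h => v h y) x = vx -> derive1 (fun h => v x h) y = vy ->
  Dnorm u v x y = Num.sqrt ((ux + vy) ^+ 2 + (vx - uy) ^+ 2) / 2
    + Num.sqrt ((ux - vy) ^+ 2 + (vx + uy) ^+ 2) / 2.
Proof. by move=> <- <- <- <-. Qed.

(** * The derivative of the Poisson integral at the origin *)

Section DerivativeAtOrigin.
Context {R : realType}.
Notation mu := (@lebesgue_measure R).
Notation circle := (`[0, 2 * pi]%classic : set R).

(** For real [z = h] the point [z e^(-it)] has modulus [|h|] and real part [h cos t], so the kernel
    is the one-variable [kernel] at [cos t]. *)
Lemma derive_P_alpha_x (a : R) (g : R -> R) : mu.-integrable circle (EFin \o g) ->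
  derive1 (fun h => P_alpha a g h 0) 0 =
  (a + 2) * c_alpha a * ((2 * pi)^-1 * \int[mu]_(t in circle) (cos t * g t)).
Proof.
move=> ig; rewrite [X in derive1 X](_ : _ = (fun h => (2 * pi)^-1 *
    \int[mu]_(t in circle) (c_alpha a * kernel a h (cos t) * g t))).
  apply: derive_kernel_integral => //; last exact: cos_max.
  by apply: continuous_measurable_fun; exact: continuous_cos.
apply/funext => h; rewrite /P_alpha; congr (_ * _).
apply: eq_Rintegral => t _; congr (_ * _); apply: K_alphaE; first by ring.
by rewrite mul0r addr0 mul0r sub0r sqrrN !exprMn -mulrDr cos2Dsin2 mulr1.
Qed.

Lemma derive_P_alpha_y (a : R) (g : R -> R) : mu.-integrable circle (EFin \o g) ->
  derive1 (fun h => P_alpha a g 0 h) 0 =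
  (a + 2) * c_alpha a * ((2 * pi)^-1 * \int[mu]_(t in circle) (sin t * g t)).
Proof.
move=> ig; rewrite [X in derive1 X](_ : _ = (fun h => (2 * pi)^-1 *
    \int[mu]_(t in circle) (c_alpha a * kernel a h (sin t) * g t))).
  apply: derive_kernel_integral => //; last exact: sin_max.
  by apply: continuous_measurable_fun; exact: continuous_sin.
apply/funext => h; rewrite /P_alpha; congr (_ * _).
apply: eq_Rintegral => t _; congr (_ * _); apply: K_alphaE; first by ring.
by rewrite !mul0r add0r subr0 !exprMn -mulrDr addrC cos2Dsin2 mulr1.
Qed.

Lemma Rintegral_linear (x y : R) (f g : R -> R) :
  mu.-integrable circle (EFin \o f) -> mu.-integrable circle (EFin \o g) ->
  \int[mu]_(t in circle) (x * f t + y * g t) =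
  x * \int[mu]_(t in circle) f t + y * \int[mu]_(t in circle) g t.
Proof.
move=> fi gi; rewrite RintegralD//; first by rewrite !RintegralZl.
- by apply: (integrable_bounded_mul (fun=> x) f `|x|).
- by apply: (integrable_bounded_mul (fun=> y) g `|y|).
Qed.

Lemma integrable_linear (x y : R) (f g : R -> R) :
  mu.-integrable circle (EFin \o f) -> mu.-integrable circle (EFin \o g) ->
  mu.-integrable circle (EFin \o (fun t => x * f t + y * g t)).
Proof.
move=> fi gi.
have i1 : mu.-integrable circle (EFin \o (fun t => x * f t)).
  by apply: (integrable_bounded_mul (fun=> x) f `|x|).
have i2 : mu.-integrable circle (EFin \o (fun t => y * g t)).
  by apply: (integrable_bounded_mul (fun=> y) g `|y|).
have /= := @integrableD _ _ _ mu _ (measurable_itv _) _ _ i1 i2.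
by apply: eq_integrable => // t _ /=; rewrite EFinD.
Qed.

Lemma integrable_wave_mul (d1 d2 : R) (g : R -> R) : d1 ^+ 2 + d2 ^+ 2 = 1 ->
  mu.-integrable circle (EFin \o g) ->
  mu.-integrable circle (EFin \o (fun t => wave d1 d2 t * g t)).
Proof.
move=> d ig; apply: (integrable_bounded_mul _ _ 1) => //.
  by apply: measurable_funTS; apply: continuous_measurable_fun; exact: continuous_wave.
by move=> t _; exact: norm_wave_le1.
Qed.

Lemma Rintegral_wave_mul (d1 d2 : R) (g : R -> R) :
  mu.-integrable circle (EFin \o g) ->
  \int[mu]_(t in circle) (wave d1 d2 t * g t) =
  d1 * \int[mu]_(t in circle) (cos t * g t) + d2 * \int[mu]_(t in circle) (sin t * g t).
Proof.
move=> ig; rewrite -Rintegral_linear.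
- by apply: eq_Rintegral => t _; rewrite /wave; ring.
- apply: (integrable_bounded_mul _ _ 1) => //; last by move=> t _; exact: cos_max.
  by apply: measurable_funTS; apply: continuous_measurable_fun; exact: continuous_cos.
- apply: (integrable_bounded_mul _ _ 1) => //; last by move=> t _; exact: sin_max.
  by apply: measurable_funTS; apply: continuous_measurable_fun; exact: continuous_sin.
Qed.

(** Contracting the Jacobian with a unit direction [d] in the disk and a unit vector [e] in the
    target turns the norm into one integral, with wave [d] against the component of the boundary
    function along [e]. *)
Lemma Dnorm_P_alpha (a : R) (u v : R -> R) :
  mu.-integrable circle (EFin \o u) -> mu.-integrable circle (EFin \o v) ->
  exists d1 d2 e1 e2 : R, [/\ d1 ^+ 2 + d2 ^+ 2 = 1, e1 ^+ 2 + e2 ^+ 2 = 1 &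
    Dnorm (P_alpha a u) (P_alpha a v) 0 0 =
    (a + 2) * c_alpha a * ((2 * pi)^-1 *
      \int[mu]_(t in circle) (wave d1 d2 t * (e1 * u t + e2 * v t)))].
Proof.
move=> iu iv.
rewrite (DnormE _ _ _ _ _ _ _ _ (derive_P_alpha_x a u iu) (derive_P_alpha_y a u iu)
  (derive_P_alpha_x a v iv) (derive_P_alpha_y a v iv)).
set ux := _ * (_ * \int[mu]_(t in _) (cos t * u t)).
set uy := _ * (_ * \int[mu]_(t in _) (sin t * u t)).
set vx := _ * (_ * \int[mu]_(t in _) (cos t * v t)).
set vy := _ * (_ * \int[mu]_(t in _) (sin t * v t)).
have [d1 [d2 [e1 [e2 [d e ->]]]]] := operator_norm_attained ux uy vx vy.
exists d1, d2, e1, e2; split => //.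
have -> : \int[mu]_(t in circle) (wave d1 d2 t * (e1 * u t + e2 * v t)) =
    e1 * \int[mu]_(t in circle) (wave d1 d2 t * u t) +
    e2 * \int[mu]_(t in circle) (wave d1 d2 t * v t).
  rewrite -Rintegral_linear; [|exact: integrable_wave_mul..].
  by apply: eq_Rintegral => t _; ring.
rewrite !Rintegral_wave_mul// /ux /uy /vx /vy.
by move: (2 * pi)^-1 => k; ring.
Qed.

End DerivativeAtOrigin.

(** * The bound and its sharpness *)

Section SharpBound.
Context {R : realType}.
Notation mu := (@lebesgue_measure R).
Notation circle := (`[0, 2 * pi]%classic : set R).

Lemma Gamma_ge0 (s : R) : 0 <= Gamma s.
Proof. by apply: Rintegral_ge0 => t _; rewrite mulr_ge0 ?powR_ge0 ?expR_ge0. Qed.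

Lemma c_alpha_ge0 (a : R) : 0 <= c_alpha a.
Proof. by rewrite divr_ge0 ?sqr_ge0 ?Gamma_ge0. Qed.

(** Valid for every unit vector, so it can be applied both to the maximising direction of a given
    function and to [cos]. *)
Lemma sharp_constE (a : R) (p : \bar R) (d1 d2 : R) : (1 < p)%E ->
  d1 ^+ 2 + d2 ^+ 2 = 1 ->
  sharp_const a p = (a + 2) * c_alpha a *
    ((2 * pi)^-1 * wave_moment d1 d2 (conj_exp p)) `^ (conj_exp p)^-1.
Proof.
move=> p1 d; rewrite wave_momentE ?conj_exp_ge1// /sharp_const /c_alpha.
by rewrite (addrC 2 a) !mulrA.
Qed.

Lemma measurable_cmod_fun (u v : R -> R) : measurable_fun circle u ->
  measurable_fun circle v -> measurable_fun circle (cmod_fun u v).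
Proof.
move=> mu_ mv; apply: (@measurableT_comp _ _ _ _ _ _ (@Num.sqrt R)).
  by apply: continuous_measurable_fun; exact: sqrt_continuous.
by apply: measurable_funD; exact: measurable_funX.
Qed.

Lemma norm_dot_le (e1 e2 x y : R) : e1 ^+ 2 + e2 ^+ 2 = 1 ->
  `|e1 * x + e2 * y| <= Num.sqrt (x ^+ 2 + y ^+ 2).
Proof.
move=> e; rewrite -sqrtr_sqr ler_wsqrtr//.
have -> : x ^+ 2 + y ^+ 2 = (e1 * x + e2 * y) ^+ 2 + (e2 * x - e1 * y) ^+ 2.
  by rewrite -[LHS]mul1r -e; ring.
by rewrite lerDl sqr_ge0.
Qed.

(** The component [e1 u + e2 v] is bounded pointwise by the modulus [w], so Hoelder's inequality is
    applied to [w] and the complex case costs no extra constant. *)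
Lemma Dnorm_le_sharp_const (a : R) (p : \bar R) (u v : R -> R) :
  -1 < a -> (1 < p)%E -> in_Lp p u v ->
  ((Dnorm (P_alpha a u) (P_alpha a v) 0 0)%:E
     <= (sharp_const a p)%:E * Tnorm p (cmod_fun u v))%E.
Proof.
move=> a1 p1 [mu_ [mv wy]]; set w := cmod_fun u v in wy *.
have mw : measurable_fun circle w by exact: measurable_cmod_fun.
have iw := Tnorm_integrable p w p1 mw wy.
have w0 t : 0 <= w t by exact: sqrtr_ge0.
have iu : mu.-integrable circle (EFin \o u).
  apply: le_integrable iw => //; first exact/measurable_EFinP.
  move=> t _ /=; rewrite lee_fin (ger0_norm (w0 t)).
  have := @norm_dot_le 1 0 (u t) (v t); rewrite mul1r mul0r addr0; apply; ring.
have iv : mu.-integrable circle (EFin \o v).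
  apply: le_integrable iw => //; first exact/measurable_EFinP.
  move=> t _ /=; rewrite lee_fin (ger0_norm (w0 t)).
  have := @norm_dot_le 0 1 (u t) (v t); rewrite mul1r mul0r add0r; apply; ring.
have [d1 [d2 [e1 [e2 [d e ->]]]]] := Dnorm_P_alpha a u v iu iv.
have K0 : 0 <= (a + 2) * c_alpha a by rewrite mulr_ge0 ?c_alpha_ge0//; lra.
rewrite (sharp_constE a p d1 d2)// [in leRHS]EFinM -muleA EFinM.
apply: lee_wpmul2l; first by rewrite lee_fin.
have mb : measurable_fun circle (wave d1 d2).
  by apply: measurable_funTS; apply: continuous_measurable_fun; exact: continuous_wave.
have b1 t := norm_wave_le1 d1 d2 t d.
apply: le_trans (hoelder_circle p (wave d1 d2) w p1 mb b1 mw wy).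
have k0 : 0 <= (2 * pi)^-1 :> R by rewrite invr_ge0 ltW ?twopi_gt0.
rewrite EFinM; apply: lee_wpmul2l; first by rewrite lee_fin.
have iuv := integrable_linear e1 e2 u v iu iv.
have ibuv := integrable_wave_mul d1 d2 _ d iuv.
have ibw := integrable_norm (integrable_wave_mul d1 d2 _ d iw).
rewrite -[leRHS]fineK; last exact: integrable_fin_num.
rewrite lee_fin; apply: (le_trans (ler_norm _)).
apply: (@le_trans _ _ (\int[mu]_(t in circle)
    `|wave d1 d2 t * (e1 * u t + e2 * v t)|)).
  exact: le_normr_Rintegral.
apply: le_Rintegral => //; first exact: integrable_norm.
by move=> t _; rewrite /= !normrM ler_wpM2l// (ger0_norm (w0 t)) norm_dot_le.
Qed.

(* Equality case in Hoelder's inequality for [|cos|] *)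
Definition extremal (q t : R) : R :=
  (if 0 <= cos t then 1 else -1) * `|cos t| `^ (q - 1).

Lemma measurable_extremal (q : R) : measurable_fun setT (extremal q).
Proof.
have mcos : measurable_fun setT (@cos R).
  by apply: continuous_measurable_fun; exact: continuous_cos.
apply: measurable_funM.
  by apply: measurable_fun_ifT => //; exact: measurable_fun_ler.
apply: (@measurableT_comp _ _ _ _ _ _ (@powR R ^~ (q - 1))) => //.
exact: measurableT_comp.
Qed.

Lemma cmod_extremal (q t : R) : cmod_fun (extremal q) (fun=> 0) t = `|cos t| `^ (q - 1).
Proof.
rewrite /cmod_fun expr0n/= addr0 sqrtr_sqr /extremal normrM.
by rewrite (ger0_norm (powR_ge0 _ _)); case: ifP => _; rewrite ?normrN normr1 mul1r.
Qed.

Lemma cos_extremal (q t : R) : 1 <= q -> cos t * extremal q t = `|wave 1 0 t| `^ q.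
Proof.
move=> q1; rewrite /extremal /wave mul1r mul0r addr0 mulrA.
have -> : cos t * (if 0 <= cos t then 1 else -1) = `|cos t|.
  have [c0|c0] := leP 0 (cos t); first by rewrite mulr1 ger0_norm.
  by rewrite mulrN1 ltr0_norm.
by rewrite mulr_powRB1// (lt_le_trans ltr01).
Qed.

(** Let [M] be the normalised moment. For finite [p], [(q - 1) p = q] makes the norm [M^(1/p)], and
    [M = M^(1/q) M^(1/p)] is equality in Hoelder. For [p = +oo] the exponent [q - 1] is 0, and
    [0^0 = 1] makes the modulus 1 everywhere, zeros of [cos] included. *)
Lemma Tnorm_extremal (p : \bar R) (q := conj_exp p) : (1 < p)%E ->
  exists2 T : R, 0 < T &
    Tnorm p (cmod_fun (extremal q) (fun=> 0)) = T%:E /\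
    (2 * pi)^-1 * wave_moment 1 0 q = ((2 * pi)^-1 * wave_moment 1 0 q) `^ q^-1 * T.
Proof.
move=> p1; have q1 := conj_exp_ge1 p p1; rewrite -/q in q1.
set M := (2 * pi)^-1 * wave_moment 1 0 q.
have M0 : 0 < M.
  rewrite /M wave_momentE//; last by ring.
  by rewrite divr_gt0 ?mulr_gt0 ?sqrtr_gt0 ?pi_gt0 ?Gamma_gt0//; lra.
rewrite (_ : cmod_fun _ _ = (fun t => `|cos t| `^ (q - 1))); last first.
  by apply/funext => t; exact: cmod_extremal.
case: p p1 @q q1 @M M0 => [r||]//= r1 q1 M0.
- rewrite lte_fin in r1.
  set q := r / (r - 1) in q1 M0 *; set M := _ * _ in M0 *.
  have r0 : 0 < r := lt_trans ltr01 r1.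
  have qr : q^-1 + r^-1 = 1 by rewrite /q invf_div; field; rewrite gt_eqF.
  have q1r : (q - 1) * r = q by rewrite /q; field; rewrite subr_eq0 gt_eqF.
  exists (M `^ r^-1); first exact: powR_gt0.
  split; last by rewrite -powRD ?qr ?oner_eq0// powRr1// ltW.
  rewrite -poweR_EFin; congr (_ `^ _)%E; rewrite /M EFinM; congr (_ * _)%E.
  rewrite /wave_moment /Rintegral fineK; last first.
    apply: integrable_fin_num => //; apply: integrable_wave_powR; lra.
  apply: eq_integral => t _; rewrite (ger0_norm (powR_ge0 _ _)) -powRrM q1r.
  by rewrite /wave mul1r mul0r addr0.
- exists 1 => //; split; last by rewrite invr1 mulr1 powRr1// ltW.
  apply: ess_sup_ae_cst; last first.
    by apply: nearW => t; rewrite subrr powRr0 normr1.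
  rewrite /= /mrestr setTI lebesgue_measure_itv/= lte_fin twopi_gt0.
  by rewrite -EFinD subr0 lte_fin twopi_gt0.
Qed.

(** For the real function [extremal q] the derivative [ux] alone equals the sharp constant times the
    norm [T]; comparison with the assumed bound [C * T] and division by [T > 0] give the claim. *)
Lemma sharp_const_le (a : R) (p : \bar R) (C : R) : -1 < a -> (1 < p)%E ->
  (forall u v : R -> R, in_Lp p u v ->
     ((Dnorm (P_alpha a u) (P_alpha a v) 0 0)%:E
        <= C%:E * Tnorm p (cmod_fun u v))%E) ->
  sharp_const a p <= C.
Proof.
move=> a1 p1; pose q := conj_exp p; have q1 := conj_exp_ge1 p p1.
have [T T0 [TE MT]] := Tnorm_extremal p p1.
have mext : measurable_fun circle (extremal q).
  by apply: measurable_funTS; exact: measurable_extremal.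
have Lp : in_Lp p (extremal q) (fun=> 0) by split => //; split => //; rewrite TE ltry.
move=> /(_ _ _ Lp); rewrite TE -EFinM lee_fin => hC.
have iext : mu.-integrable circle (EFin \o extremal q).
  have := Tnorm_integrable p (cmod_fun (extremal q) (fun=> 0)) p1.
  rewrite TE => /(_ (measurable_cmod_fun _ _ mext (measurable_cst _)) (ltry _)).
  apply: le_integrable => //; first exact/measurable_EFinP.
  by move=> t _ /=; rewrite lee_fin /cmod_fun expr0n/= addr0 sqrtr_sqr normr_id.
rewrite (sharp_constE a p 1 0)//; last by ring.
rewrite -(ler_pM2r T0) -(mulrA ((a + 2) * c_alpha a)) -MT; apply: le_trans hC.
have i0 : mu.-integrable circle (EFin \o (fun=> 0 : R)).
  by apply: continuous_integrable_itv => t; exact: cvg_cst.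
rewrite (DnormE _ _ _ _ _ _ _ _ (derive_P_alpha_x a _ iext) (derive_P_alpha_y a _ iext)
  (derive_P_alpha_x a _ i0) (derive_P_alpha_y a _ i0)).
apply: le_trans (ler_wirtinger_sum _ _ _ _).
apply: ler_wpM2l; first by rewrite mulr_ge0 ?c_alpha_ge0//; lra.
apply: ler_wpM2l; first by rewrite invr_ge0 ltW ?twopi_gt0.
by under [leRHS]eq_Rintegral do rewrite cos_extremal//.
Qed.

End SharpBound.

Theorem theorem2 (R : realType) (a : R) (p : \bar R) :
  -1 < a -> (1 < p)%E ->
  (forall u v : R -> R, in_Lp p u v ->
     ((Dnorm (P_alpha a u) (P_alpha a v) 0 0)%:E
        <= (sharp_const a p)%:E * Tnorm p (cmod_fun u v))%E)
  /\
  (forall C : R,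
     (forall u v : R -> R, in_Lp p u v ->
        ((Dnorm (P_alpha a u) (P_alpha a v) 0 0)%:E
           <= C%:E * Tnorm p (cmod_fun u v))%E) ->
     sharp_const a p <= C).
Proof.
move=> a1 p1; split; first by move=> u v; exact: Dnorm_le_sharp_const.
by move=> C; exact: sharp_const_le.
Qed.
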